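(* Let $0<\gamma<1$, $1<\alpha<2$, $\lambda\ge0$, $\rho>0$, $\eta\in\mathbb{R}$, $J=\sqrt{-1}$, $p=\rho+J\eta$, $K>0$, $b>0$, $T>0$, $U:[0,b]\to[0,\infty)$, $\widetilde{\lambda}_i=\lambda+pU(x_i)$. Let $G(x,p,t)$ be the exact solution of the time-tempered fractional Feynman–Kac problem described in the context. For integers $M\ge2$, $N\ge1$, $h=b/M$, $\tau>0$ with $N\tau\le T$, $x_i=ih$, $t_n=n\tau$, let $G_{i,p}^n$ be computed by the scheme $$\frac{1}{\tau^\gamma}\sum_{k=0}^{n}l_k^{(2)}e^{-J\eta U(x_i)k\tau}G_{i,p}^{n-k}-\kappa\frac{1}{h^\alpha}\sum_{j=0}^{M}w_{i,j}^\alpha G_{j,p}^n=\frac{1}{\tau^\gamma}\sum_{k=0}^{n}l_k^{2,\gamma}e^{-\widetilde{\lambda}_i n\tau}G_{i,p}^0+f(x_i,p,t_n)$$ for $1\le i\le M-1$, $1\le n\le N$, with $G_{i,p}^0=G(x_i,p,0)$ and $G_{0,p}^n=G_{M,p}^n=0$. Assume the local truncation error $r_i^n$ (the residual obtained by substituting $G(x_j,p,t_m)$ for $G_{j,p}^m$ in the scheme, moved to the right-hand side) satisfies $|r_i^n|\le C_G(\tau^2+h^2)$ for all $i,n$, with $C_G>0$ independent of $\tau,h$. Let $\varepsilon_i^n=G(x_i,p,t_n)-G_{i,p}^n$. Then $$\tau\sum_{n=1}^{N}\|\varepsilon^n\|\le\frac{C_G|\Gamma(1-\alpha)|\,b^{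\alpha+\frac12}T}{2\kappa}(\tau^2+h^2).$$
   Context: The problem: for $x\in(0,b)$, $t\in(0,T]$, $${}_C^SD_t^{\gamma,\widetilde{\lambda}}G(x,p,t)=K\nabla_x^\alpha G(x,p,t)+f(x,p,t),\quad G(x,p,0)=G_0(x,p),\quad G(x,p,t)=0\ \text{for } x\notin(0,b),$$ where $\widetilde{\lambda}=\lambda+pU(x)$, ${}_C^SD_t^{\gamma,\widetilde{\lambda}}G=D_t^{\gamma,\widetilde{\lambda}}\left[G-e^{-\widetilde{\lambda}t}G(x,p,0)\right]-\lambda^\gamma G$ with $D_t^{\gamma,\widetilde{\lambda}}G=\frac{1}{\Gamma(1-\gamma)}\left[\partial_t+\widetilde{\lambda}\right]\int_0^t(t-z)^{-\gamma}e^{-\widetilde{\lambda}(t-z)}G(x,p,z)\,dz$, and $\nabla_x^\alpha=-\kappa_\alpha({}_0D_x^\alpha+{}_xD_b^\alpha)$ is the Riesz derivative built from the left/right Riemann–Liouville derivatives of order $\alpha$. Notation: $\kappa_\alpha=\frac{1}{2\cos(\alpha\pi/2)}$, $\kappa=-K\kappa_\alpha>0$. $g_k^\beta=(-1)^k\binom{\beta}{k}$. $l_k^{2,\gamma}$ are defined by $\left((1-\zeta)+\tfrac12(1-\zeta)^2\right)^{\gamma}=\sum_k l_k^{2,\gamma}\zeta^k$. $l_0^{(2)}=l_0^{2,\gamma}-\left(\sum_{l=1}^{2}\frac1l(1-e^{-\lambda\tau})^l\right)^{\gamma}$ and $l_k^{(2)}=e^{-(\lambda+\rho U(x_i))k\tau}l_k^{2,\gamma}$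 for $k\ge1$. $w_0^\alpha=\frac{\alpha}{2}g_0^\alpha$, $w_k^\alpha=\frac{\alpha}{2}g_k^\alpha+\frac{2-\alpha}{2}g_{k-1}^\alpha$ ($k\ge1$); $w_{i,j}^\alpha=w^\alpha_{i-j+1}$ if $j<i-1$, $w_0^\alpha+w_2^\alpha$ if $j=i\pm1$, $2w_1^\alpha$ if $j=i$, $w^\alpha_{j-i+1}$ if $j>i+1$. $\|\varepsilon^n\|^2=h\sum_{i=1}^{M-1}|\varepsilon_i^n|^2$. *)

(* Defs.v *)
From Stdlib Require Import Reals Factorial.
From Coquelicot Require Import Coquelicot.

Open Scope R_scope.

(** x^a for x >= 0 with the convention 0^a = 0 (a > 0). *)
Definition rpow0 (x a : R) : R := if Rlt_dec 0 x then Rpower x a else 0.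

(** Euler Gamma function: for s > 0 the improper integral
    int_0^oo t^(s-1) e^(-t) dt; for -1 < s < 0 via Gamma(s) = Gamma(s+1)/s. *)
Definition Gamma_pos (s : R) : R :=
  RInt_gen (fun t => Rpower t (s - 1) * exp (- t))
           (at_right 0) (Rbar_locally p_infty).
Definition Gamma (s : R) : R :=
  if Rlt_dec 0 s then Gamma_pos s else Gamma_pos (s + 1) / s.

Fixpoint falling (a : R) (k : nat) : R :=
  match k with O => 1 | S k' => falling a k' * (a - INR k') end.
Definition gbinom (a : R) (k : nat) : R := falling a k / INR (Factorial.fact k).

Definition gcoef (beta : R) (k : nat) : R := (-1) ^ k * gbinom beta k.

Definition wcoef (alpha : R) (k : nat) : R :=
  match k with
  | O => alpha / 2 * gcoef alpha 0
  | S k' => alpha / 2 * gcoef alpha k + (2 - alpha) / 2 * gcoef alpha k'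
  end.

Definition wmat (alpha : R) (i j : nat) : R :=
  if Nat.ltb (j + 1) i then wcoef alpha (i - j + 1)
  else if orb (Nat.eqb (j + 1) i) (Nat.eqb j (i + 1)) then wcoef alpha 0 + wcoef alpha 2
  else if Nat.eqb j i then 2 * wcoef alpha 1
  else wcoef alpha (j - i + 1).

Definition lcoef (gamma : R) (k : nat) : R :=
  Derive_n (fun z => Rpower ((1 - z) + / 2 * (1 - z) ^ 2) gamma) k 0
  / INR (Factorial.fact k).

Definition l0_2 (gamma lambda tau : R) : R :=
  lcoef gamma 0
  - rpow0 (sum_n_m (fun l => / INR l * (1 - exp (- lambda * tau)) ^ l) 1 2) gamma.

Definition kappa_alpha (alpha : R) : R := / (2 * cos (alpha * PI / 2)).
Definition kappa (K alpha : R) : R := - K * kappa_alpha alpha.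

Definition cexp (z : C) : C :=
  (exp (fst z) * cos (snd z), exp (fst z) * sin (snd z)).

Definition Jc : C := (0, 1).

Definition hstep (b : R) (M : nat) : R := b / INR M.
Definition xg (b : R) (M i : nat) : R := INR i * hstep b M.
Definition tg (tau : R) (n : nat) : R := INR n * tau.

(** Coefficient of G^{n-k}_{i,p} in the time discretization:
    l_k^{(2)} e^{-J eta U(x_i) k tau}, with l_0^{(2)} as above and
    l_k^{(2)} = e^{-(lambda + rho U(x_i)) k tau} l_k^{2,gamma} for k >= 1. *)
Definition tcoef (gamma lambda rho eta tau : R) (Ui : R) (k : nat) : C :=
  match k with
  | O => RtoC (l0_2 gamma lambda tau)
  | S _ => Cmult (RtoC (exp (- (lambda + rho * Ui) * INR k * tau) * lcoef gamma k))
                 (cexp (Cmult Jc (RtoC (- eta * Ui * INR k * tau))))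
  end.

Definition scheme_lhs (gamma alpha lambda rho eta K b : R) (U : R -> R)
  (M : nat) (tau : R) (V : nat -> nat -> C) (i n : nat) : C :=
  Cplus
    (Cmult (RtoC (/ Rpower tau gamma))
       (sum_n (fun k => Cmult (tcoef gamma lambda rho eta tau (U (xg b M i)) k)
                              (V i (n - k)%nat)) n))
    (Copp (Cmult (RtoC (kappa K alpha / Rpower (hstep b M) alpha))
       (sum_n (fun j => Cmult (RtoC (wmat alpha i j)) (V j n)) M))).

Definition scheme_rhs (gamma lambda rho eta b : R) (U : R -> R)
  (f : R -> C -> R -> C) (M : nat) (tau : R) (G0i : C) (i n : nat) : C :=
  let p : C := (rho, eta) in
  let lt : C := Cplus (RtoC lambda) (Cmult p (RtoC (U (xg b M i)))) in
  Cplus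
    (Cmult (RtoC (/ Rpower tau gamma))
       (sum_n (fun k => Cmult (Cmult (RtoC (lcoef gamma k))
                                     (cexp (Copp (Cmult lt (RtoC (tg tau n))))))
                              G0i) n))
    (f (xg b M i) p (tg tau n)).

Definition dnorm (b : R) (M : nat) (e : nat -> C) : R :=
  sqrt (hstep b M * sum_n_m (fun i => Cmod (e i) ^ 2) 1 (M - 1)).

(* Main.v *)
(** Testing the error equation with the conjugate of the error and summing over all grid points
    leaves two forms to be bounded from below.

    Time: after rotating the phases away, the form is real with symbol
    [delta(r z)^gamma - delta(exp (-lambda tau))^gamma], [delta(z) = (1-z) + (1-z)^2/2]. Multiplication
    by [delta(r z)] is an operator [D] with [Re D >= delta(r)]; for large [c] the operator
    [Y = 1 - (D + 2e)/c] satisfies [|Y| <= q = 1 - (delta(r) + e)/c]. In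
    [(D + 2e)^gamma = c^gamma (1 - Y)^gamma] the binomial series has only nonpositive coefficients
    after the constant one, so the form of [(D + 2e)^gamma] is at least [(delta(r) + e)^gamma]; let
    [e] tend to 0. The coefficients are identified through the recurrence coming from the
    differential equation of [delta^gamma].

    Space: the weights are a symmetric matrix with nonnegative off-diagonal entries, so its form is
    governed by the row sums. These are partial sums of Grunwald weights, i.e. the binomial
    coefficients of order [alpha - 1], compared with [M^(-alpha) / |Gamma(1 - alpha)|] by
    [Gamma(m - a) >= m^(-a) Gamma(m)]. *)
Require Import Defs.
From Stdlib Require Import Reals Factorial Lra Lia Psatz ClassicalEpsilon.
From Coquelicot Require Import Coquelicot.
Open Scope R_scope.

(** * Toeplitz forms of powers of a second-order symbol *)

(** The time form enters the final estimate only through its sign; the whole constant comes from the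
    coercivity in space. The sign is delicate because the scheme subtracts exactly the power of the
    symbol at [exp (- lambda * tau)], which uses up the whole lower bound where [U] vanishes. The
    fractional power of an operator on finitely many time levels is approached by polynomials: the
    binomial series of [(1 - Y)^gamma] is truncated at a degree [K], so that only finite sums and
    real inner products occur. Of the two [e] added to [D], one pays for the quadratic term in
    [|Y v|^2]; the other keeps [q < 1] even at [r = 1], where [delta(r) = 0]. The truncated sum
    satisfies the differential equation of the power up to a single term containing [Y^K], which the
    same contraction makes as small as [q^K]. Its coefficients thus solve a perturbed recurrence,
    and letting the perturbation vanish identifies them with [lcoef] without any closed formula. *)

Lemma gcoef_0 (b : R) : gcoef b 0 = 1.
Proof. unfold gcoef, gbinom; simpl; field. Qed.

Lemma gcoef_S (b : R) (k : nat) :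
  gcoef b (S k) * INR (S k) = (INR k - b) * gcoef b k.
Proof.
  unfold gcoef, gbinom. rewrite fact_simpl, mult_INR. cbn [falling pow].
  field. split; [apply INR_fact_neq_0 | apply not_0_INR; lia].
Qed.

Lemma gcoef_S_div (b : R) (k : nat) :
  gcoef b (S k) = (INR k - b) * gcoef b k / INR (S k).
Proof. rewrite <- gcoef_S. field. apply not_0_INR; lia. Qed.

Lemma gcoef_neg (g : R) (k : nat) : 0 < g < 1 -> gcoef g (S k) < 0.
Proof.
  intros Hg. induction k as [|k IH].
  - rewrite gcoef_S_div, gcoef_0. simpl. lra.
  - rewrite gcoef_S_div.
    assert (H1 : 0 < INR (S (S k))) by (apply lt_0_INR; lia).
    assert (H2 : 1 <= INR (S k)) by (rewrite S_INR; pose proof (pos_INR k); lra).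
    apply Rmult_lt_reg_r with (INR (S (S k))); [exact H1|].
    field_simplify; nra.
Qed.

(** This is the factor of the one residual term left when the binomial series is truncated at degree
    [k]. It equals [g] at [k = 0], and each step multiplies it by [(k + 1 - g) / (k + 1) < 1]. *)
Lemma gcoef_residue_bounds (g : R) (k : nat) :
  0 < g < 1 -> 0 <= - (INR k - g) * gcoef g k <= 1.
Proof.
  intros Hg. induction k as [|k IH].
  - rewrite gcoef_0; simpl; lra.
  - pose proof (gcoef_neg g k Hg). pose proof (gcoef_S g k) as E.
    assert (H2 : 1 <= INR (S k)) by (rewrite S_INR; pose proof (pos_INR k); lra).
    nra.
Qed.

Definition shift (u : nat -> R) (n : nat) : R :=
  match n with O => 0 | S m => u m end.

(* Multiplication of the formal power series [sum u_n z^n] by [a + b z + c z^2]. *)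
Definition quad (a b c : R) (u : nat -> R) (n : nat) : R :=
  a * u n + b * shift u n + c * shift (shift u) n.

Definition ip (N : nat) (u v : nat -> R) : R :=
  sum_f_R0 (fun n => u n * v n) N.

Definition conv (a v : nat -> R) (n : nat) : R :=
  sum_f_R0 (fun k => a k * v (n - k)%nat) n.

(** The power series 1: neutral for [conv], and the seed from which powers of a polynomial are
    generated. *)
Definition unit_seq (n : nat) : R := match n with O => 1 | _ => 0 end.

Lemma ip_sq_nonneg (N : nat) (u : nat -> R) : 0 <= ip N u u.
Proof. apply cond_pos_sum. intros; nra. Qed.

Lemma ip_lincomb (N : nat) (a b : R) (u v w : nat -> R) :
  ip N (fun n => a * u n + b * v n) w = a * ip N u w + b * ip N v w.
Proof. unfold ip. induction N as [|N IH]; simpl; [|rewrite IH]; ring. Qed.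

Lemma ip_sym (N : nat) (u v : nat -> R) : ip N u v = ip N v u.
Proof. apply sum_eq. intros; ring. Qed.

Lemma ip_ext (N : nat) (u u' v v' : nat -> R) :
  (forall n, u n = u' n) -> (forall n, v n = v' n) -> ip N u v = ip N u' v'.
Proof. intros H1 H2. apply sum_eq. intros; rewrite H1, H2; ring. Qed.

Lemma ip_shift_le (N : nat) (u : nat -> R) : ip N (shift u) (shift u) <= ip N u u.
Proof.
  assert (E : ip N (shift u) (shift u) + u N * u N = ip N u u).
  { unfold ip. induction N as [|N IH]; simpl in *; [ring|]. rewrite <- IH. ring. }
  pose proof (Rle_0_sqr (u N)) as H; unfold Rsqr in H. lra.
Qed.

Lemma ip_quad_le (N : nat) (a b c : R) (u : nat -> R) :
  ip N (quad a b c u) (quad a b c u) <= 3 * (a ^ 2 + b ^ 2 + c ^ 2) * ip N u u.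
Proof.
  pose proof (ip_shift_le N u) as H1. pose proof (ip_shift_le N (shift u)) as H2.
  apply Rle_trans with
    (3 * (a ^ 2 * ip N u u + b ^ 2 * ip N (shift u) (shift u)
          + c ^ 2 * ip N (shift (shift u)) (shift (shift u)))).
  - unfold ip. rewrite !scal_sum, <- !plus_sum, scal_sum.
    apply sum_Rle. intros n _. unfold quad.
    generalize (u n) (shift u n) (shift (shift u) n). intros x y z.
    assert (0 <= (a * x - b * y) ^ 2 + (b * y - c * z) ^ 2 + (a * x - c * z) ^ 2)
      by (repeat apply Rplus_le_le_0_compat; apply pow2_ge_0).
    lra.
  - pose proof (pow2_ge_0 a). pose proof (pow2_ge_0 b). pose proof (pow2_ge_0 c).
    assert (b ^ 2 * ip N (shift u) (shift u) <= b ^ 2 * ip N u u) by (apply Rmult_le_compat_l; lra).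
    assert (c ^ 2 * ip N (shift (shift u)) (shift (shift u)) <= c ^ 2 * ip N u u)
      by (apply Rmult_le_compat_l; lra).
    lra.
Qed.

Definition bdf2 (z : R) : R := (1 - z) + / 2 * (1 - z) ^ 2.

(* The symbol of the left-hand form on the unit circle is
   [2r(1-r)(1-cos t) + r^2 (1-cos t)^2]; the squares below are its two terms, and the
   remaining summands come from extending [v] by zero beyond [N]. *)
Lemma bdf2_form_nonneg (N : nat) (r : R) (v : nat -> R) : 0 <= r <= 1 ->
  0 <= ip N (quad (2 * r - r ^ 2 / 2) (- 2 * r) (r ^ 2 / 2) v) v.
Proof.
  intros Hr.
  set (s := fun n => r * (1 - r) * (v n - shift v n) ^ 2
                     + r ^ 2 / 4 * (v n - 2 * shift v n + shift (shift v) n) ^ 2).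
  assert (E : ip N (quad (2 * r - r ^ 2 / 2) (- 2 * r) (r ^ 2 / 2) v) v
    = sum_f_R0 s N + r * (1 - r) * v N ^ 2
      + r ^ 2 / 4 * ((2 * v N - shift v N) ^ 2 + v N ^ 2)).
  { unfold ip, s, quad. induction N as [|N IH].
    - simpl. field.
    - rewrite !tech5, IH. simpl shift. field. }
  rewrite E.
  assert (Hs : forall n, 0 <= s n).
  { intro n; unfold s.
    apply Rplus_le_le_0_compat; (apply Rmult_le_pos; [nra | apply pow2_ge_0]). }
  pose proof (cond_pos_sum s N Hs).
  assert (0 <= r * (1 - r) * v N ^ 2) by (apply Rmult_le_pos; [nra | apply pow2_ge_0]).
  assert (0 <= r ^ 2 / 4 * ((2 * v N - shift v N) ^ 2 + v N ^ 2)).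
  { apply Rmult_le_pos; [nra|]. apply Rplus_le_le_0_compat; apply pow2_ge_0. }
  lra.
Qed.

Lemma quad_conv (a b c : R) (u v : nat -> R) (n : nat) :
  quad a b c (conv u v) n = conv (quad a b c u) v n.
Proof.
  assert (S1 : forall w m, shift (conv w v) m = conv (shift w) v m).
  { intros w [|m]; unfold conv.
    - simpl; ring.
    - rewrite decomp_sum by lia. simpl. rewrite Rmult_0_l, Rplus_0_l. reflexivity. }
  assert (S2 : shift (shift (conv u v)) n = conv (shift (shift u)) v n).
  { rewrite <- S1. destruct n as [|n]; [reflexivity|]. simpl. apply S1. }
  unfold quad at 1. rewrite S1, S2. unfold conv, quad.
  rewrite !scal_sum, <- !plus_sum. apply sum_eq. intros; ring.
Qed.

Lemma quad_comm (a b c a' b' c' : R) (u : nat -> R) (n : nat) :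
  quad a b c (quad a' b' c' u) n = quad a' b' c' (quad a b c u) n.
Proof. unfold quad. destruct n as [|[|n]]; simpl; ring. Qed.

(** * Powers of a quadratic symbol and truncated binomial series *)

Fixpoint quad_pow (a b c : R) (k : nat) (u : nat -> R) : nat -> R :=
  match k with O => u | S k' => quad a b c (quad_pow a b c k' u) end.

Lemma quad_ext (a b c : R) (u v : nat -> R) :
  (forall n, u n = v n) -> forall n, quad a b c u n = quad a b c v n.
Proof. intros H n. unfold quad. destruct n as [|[|n]]; simpl; rewrite ?H; reflexivity. Qed.

Lemma quad_pow_conv (a b c : R) (k : nat) (v : nat -> R) (n : nat) :
  quad_pow a b c k v n = conv (quad_pow a b c k unit_seq) v n.
Proof.
  revert n. induction k as [|k IH]; intro n; simpl.
  - unfold conv. destruct n as [|n]; [simpl; ring|].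
    rewrite decomp_sum by lia. simpl.
    rewrite (sum_eq _ (fun _ => 0)) by (intros; ring).
    rewrite sum_cte. ring.
  - rewrite (quad_ext a b c _ _ IH n). apply quad_conv.
Qed.

(* Euler operator [z d/dz] applied to the [k]-th power of a quadratic polynomial. *)
Lemma quad_pow_euler (a b c : R) (k n : nat) :
  INR n * quad_pow a b c (S k) unit_seq n =
  INR (S k) * quad 0 b (2 * c) (quad_pow a b c k unit_seq) n.
Proof.
  revert n. induction k as [|k IH]; intro n.
  - destruct n as [|[|[|n]]]; simpl; unfold quad; simpl; try ring.
  - set (e := quad_pow a b c (S k) unit_seq) in *.
    change (quad_pow a b c (S (S k)) unit_seq) with (quad a b c e).
    assert (Hder : INR n * quad a b c e n
       = quad a b c (fun m => INR m * e m) n + quad 0 b (2 * c) e n).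
    { unfold quad. destruct n as [|[|n]]; cbn [shift]; rewrite ?S_INR; simpl; ring. }
    rewrite Hder, (quad_ext a b c _ _ IH n).
    assert (Hc : quad a b c (fun m => INR (S k) * quad 0 b (2 * c) (quad_pow a b c k unit_seq) m) n
       = INR (S k) * quad 0 b (2 * c) e n).
    { unfold e. cbn [quad_pow]. rewrite quad_comm.
      unfold quad. destruct n as [|[|n]]; cbn [shift]; ring. }
    rewrite Hc, (S_INR (S k)). ring.
Qed.

Definition binpoly (g : R) (K : nat) (y : R) : R :=
  sum_f_R0 (fun k => gcoef g k * y ^ k) K.

(** Coefficient of [z^n] in [binpoly g K] evaluated at the polynomial [a + b z + c z^2]. *)
Definition quad_binpoly (g a b c : R) (K n : nat) : R :=
  sum_f_R0 (fun k => gcoef g k * quad_pow a b c k unit_seq n) K.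

(* Truncation of [(1 - y) F' = - g y' F], the differential equation of [F = (1 - y)^g]. *)
Lemma quad_binpoly_ode (g a b c : R) (K n : nat) :
  INR n * quad_binpoly g a b c K n
  - quad a b c (fun m => INR m * quad_binpoly g a b c K m) n
  = - g * quad 0 b (2 * c) (quad_binpoly g a b c K) n
    - (INR K - g) * gcoef g K * quad 0 b (2 * c) (quad_pow a b c K unit_seq) n.
Proof.
  assert (Q : forall a' b' c' (F : nat -> R) u m, quad a' b' c' (fun j => F j + u j) m
    = quad a' b' c' F m + quad a' b' c' u m).
  { intros a' b' c' F u [|[|m]]; unfold quad; simpl; ring. }
  assert (Qs : forall a' b' c' x u m, quad a' b' c' (fun j => x * u j) m
    = x * quad a' b' c' u m).
  { intros a' b' c' x u [|[|m]]; unfold quad; simpl; ring. }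
  revert n. induction K as [|K IH]; intro n.
  - unfold quad_binpoly. simpl sum_f_R0. rewrite gcoef_0.
    destruct n as [|[|[|n]]]; unfold quad; simpl; ring.
  - assert (E : forall m, quad_binpoly g a b c (S K) m
       = quad_binpoly g a b c K m + gcoef g (S K) * quad_pow a b c (S K) unit_seq m)
      by reflexivity.
    rewrite E.
    rewrite (quad_ext a b c _ (fun m => INR m * quad_binpoly g a b c K m
       + gcoef g (S K) * (INR m * quad_pow a b c (S K) unit_seq m)))
      by (intro m; rewrite E; ring).
    rewrite (quad_ext 0 b (2 * c) (quad_binpoly g a b c (S K)) _ E).
    rewrite !Q, !Qs.
    rewrite (quad_ext a b c _ _ (quad_pow_euler a b c K)).
    rewrite Qs.
    replace (quad a b c (quad 0 b (2 * c) (quad_pow a b c K unit_seq)) n)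
      with (quad 0 b (2 * c) (quad_pow a b c (S K) unit_seq) n) by apply quad_comm.
    specialize (IH n).
    pose proof (quad_pow_euler a b c K n) as Ee.
    pose proof (gcoef_S g K) as Eg.
    replace (INR n * (quad_binpoly g a b c K n + gcoef g (S K) * quad_pow a b c (S K) unit_seq n))
      with (INR n * quad_binpoly g a b c K n + gcoef g (S K) *
              (INR (S K) * quad 0 b (2 * c) (quad_pow a b c K unit_seq) n))
      by (rewrite <- Ee; ring).
    set (X := quad 0 b (2 * c) (quad_pow a b c K unit_seq) n) in *.
    replace (gcoef g (S K) * (INR (S K) * X)) with ((INR K - g) * gcoef g K * X)
      by (rewrite <- Eg; ring).
    lra.
Qed.

Lemma binpoly_ode (g : R) (K : nat) (y : R) :
  exists d, is_derive (binpoly g K) y d /\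
    (1 - y) * d + g * binpoly g K y = - (INR K - g) * gcoef g K * y ^ K.
Proof.
  induction K as [|K [d [Hd E]]].
  - exists 0. split.
    + apply (is_derive_ext (fun _ => 1)).
      * intro t. unfold binpoly. simpl. rewrite gcoef_0. ring.
      * apply @is_derive_const.
    + unfold binpoly. simpl. rewrite gcoef_0. ring.
  - exists (d + gcoef g (S K) * (INR (S K) * y ^ K)). split.
    + apply (is_derive_plus (binpoly g K) (fun y => gcoef g (S K) * y ^ S K)); [exact Hd|].
      auto_derive; [exact I|].
      change (match K with O => 1 | S _ => INR K + 1 end) with (INR (S K)).
      simpl Nat.pred. ring.
    + change (binpoly g (S K) y) with (binpoly g K y + gcoef g (S K) * y ^ S K).
      pose proof (gcoef_S g K) as Eg.
      replace (gcoef g (S K) * (INR (S K) * y ^ K)) with ((INR K - g) * gcoef g K * y ^ K)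
        by (rewrite <- Eg; ring).
      replace (- (INR (S K) - g) * gcoef g (S K) * y ^ S K)
        with (g * gcoef g (S K) * y ^ S K - (gcoef g (S K) * INR (S K)) * y ^ S K) by ring.
      rewrite Eg. simpl pow. simpl pow in E. lra.
Qed.

Lemma Rpower_pos (x a : R) : 0 < Rpower x a.
Proof. apply exp_pos. Qed.

Lemma exp_incr (x y : R) : x <= y -> exp x <= exp y.
Proof.
  intros [H|H]; [left; apply exp_increasing; exact H | rewrite H; apply Rle_refl].
Qed.

(** With the integrating factor [(1 - t)^(-g)], the truncated differential equation says that
    [binpoly g K t * (1 - t)^(-g)] has derivative [(1 - t)^(-g-1) * res t], where
    [0 <= res t <= t^K]. The mean value theorem on [[0, y]], starting from the value 1 at 0, gives
    both bounds. *)
Lemma binpoly_bounds (g : R) (K : nat) (y : R) : 0 < g < 1 -> 0 <= y < 1 ->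
  Rpower (1 - y) g <= binpoly g K y <= Rpower (1 - y) g + y ^ K / (1 - y).
Proof.
  intros Hg Hy.
  set (res := fun t => - (INR K - g) * gcoef g K * t ^ K).
  assert (Hder : forall t, 0 <= t < 1 ->
    is_derive (fun t => binpoly g K t * Rpower (1 - t) (- g)) t
      (Rpower (1 - t) (- g - 1) * res t)).
  { intros t Ht. destruct (binpoly_ode g K t) as [d [Hd Ed]].
    evar_last.
    - apply (is_derive_mult (binpoly g K) (fun t => Rpower (1 - t) (- g)) t d
        (g * Rpower (1 - t) (- g - 1))); [exact Hd | | exact Rmult_comm].
      unfold Rpower. auto_derive; [lra|].
      replace ((- g - 1) * ln (1 - t)) with (- g * ln (1 - t) + - ln (1 - t)) by ring.
      rewrite exp_plus, exp_Ropp, exp_ln by lra.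
      field_simplify; [|lra|lra]. reflexivity.
    - unfold res. unfold plus, mult; simpl. rewrite <- Ed.
      replace (Rpower (1 - t) (- g)) with (Rpower (1 - t) (- g - 1) * (1 - t)).
      + ring.
      + rewrite <- (Rpower_1 (1 - t)) at 2 by lra. rewrite <- Rpower_plus. f_equal. ring. }
  destruct (MVT_gen (fun t => binpoly g K t * Rpower (1 - t) (- g)) 0 y
    (fun t => Rpower (1 - t) (- g - 1) * res t)) as [c [Hc E]].
  - rewrite Rmin_left, Rmax_right by lra. intros t Ht. apply Hder; lra.
  - rewrite Rmin_left, Rmax_right by lra. intros t Ht.
    apply continuity_pt_filterlim.
    apply (ex_derive_continuous (fun t => binpoly g K t * Rpower (1 - t) (- g))).
    eexists. apply Hder; lra.
  - rewrite Rmin_left, Rmax_right in Hc by lra. cbv beta in E.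
    assert (E0 : binpoly g K 0 = 1).
    { unfold binpoly. clear. induction K as [|K IH]; simpl; [rewrite gcoef_0; ring|].
      rewrite IH. ring. }
    rewrite E0, !Rminus_0_r in E.
    replace (Rpower 1 (- g)) with 1 in E
      by (unfold Rpower; rewrite ln_1, Rmult_0_r, exp_0; reflexivity).
    assert (Hres : 0 <= res c <= y ^ K).
    { unfold res. pose proof (gcoef_residue_bounds g K Hg).
      assert (0 <= c ^ K) by (apply pow_le; lra).
      assert (c ^ K <= y ^ K) by (apply pow_incr; lra).
      split; [apply Rmult_le_pos; lra|].
      apply Rle_trans with (1 * c ^ K); [apply Rmult_le_compat_r; lra | lra]. }
    assert (Hw : Rpower (1 - c) (- g - 1) <= Rpower (1 - y) (- g - 1)).
    { unfold Rpower. apply exp_incr.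
      assert (ln (1 - y) <= ln (1 - c)) by (apply Rcomplements.ln_le; lra). nra. }
    pose proof (Rpower_pos (1 - c) (- g - 1)) as Hp.
    pose proof (Rpower_pos (1 - y) g) as Hg1.
    pose proof (Rpower_pos (1 - y) (- g)) as Hg2.
    assert (Einv : Rpower (1 - y) (- g) * Rpower (1 - y) g = 1).
    { rewrite <- Rpower_plus. replace (- g + g) with 0 by ring. apply Rpower_O; lra. }
    assert (Einv1 : Rpower (1 - y) (- g - 1) * Rpower (1 - y) g = / (1 - y)).
    { rewrite <- Rpower_plus. replace (- g - 1 + g) with (- (1)) by ring.
      rewrite Rpower_Ropp, Rpower_1 by lra. reflexivity. }
    assert (Eb : binpoly g K y = Rpower (1 - y) g
       + Rpower (1 - y) g * (Rpower (1 - c) (- g - 1) * res c * y)).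
    { rewrite <- E.
      transitivity (binpoly g K y * (Rpower (1 - y) (- g) * Rpower (1 - y) g)).
      - rewrite Einv; ring.
      - ring. }
    set (x := Rpower (1 - c) (- g - 1) * res c * y) in *.
    assert (Hx : 0 <= x <= Rpower (1 - y) (- g - 1) * y ^ K).
    { assert (0 <= y ^ K) by (apply pow_le; lra).
      assert (0 <= Rpower (1 - c) (- g - 1) * res c) by (apply Rmult_le_pos; lra).
      unfold x. split; [apply Rmult_le_pos; lra|].
      apply Rle_trans with (Rpower (1 - c) (- g - 1) * res c * 1); [nra|].
      rewrite Rmult_1_r. apply Rmult_le_compat; lra. }
    rewrite Eb. split; [nra|].
    apply Rplus_le_compat_l. unfold Rdiv. rewrite <- Einv1.
    apply Rle_trans with (Rpower (1 - y) g * (Rpower (1 - y) (- g - 1) * y ^ K)); [nra|].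
    apply Req_le; ring.
Qed.

(** Write [y = q v - w / c] with [w = (D - delta(r) + e) v] and expand the square. The cross term
    gains at least [e |v|^2 / c], because [<w, v> >= e |v|^2] and [2 q >= 1]; the quadratic term
    [|w|^2 / c^2] costs at most as much, by the size of [c]. *)
Lemma ip_quad_contract (N : nat) (r e : R) (v : nat -> R) :
  0 <= r <= 1 -> 0 < e <= 1 ->
  (* 42 is [3 * (9 + 4 + 1)], the bound on [|w|^2 / |v|^2] given by [ip_quad_le]; the added 5 makes
     [42 < e * c] strict. *)
  let c := 42 / e + 5 in
  let q := 1 - (bdf2 r + e) / c in
  let y := quad (1 - (3 / 2 + 2 * e) / c) (2 * r / c) (- (r ^ 2 / 2) / c) v in
  ip N y y <= q ^ 2 * ip N v v.
Proof.
  intros Hr He c q y.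
  set (w := quad (2 * r - r ^ 2 / 2 + e) (- 2 * r) (r ^ 2 / 2) v).
  assert (Hc42 : 42 < e * c) by (unfold c; field_simplify; lra).
  assert (Hc : 42 < c) by nra.
  assert (Hq : 1 / 2 <= q).
  { unfold q. assert ((bdf2 r + e) / c <= 1 / 2); [|lra].
    apply Rle_div_l; [lra|]. unfold bdf2. nra. }
  assert (Hy : forall n, y n = q * v n + (- / c) * w n).
  { intro n. unfold y, w, q, quad, bdf2. field. lra. }
  rewrite (ip_ext N _ _ _ _ Hy Hy), ip_lincomb.
  rewrite (ip_sym N v), (ip_sym N w), !ip_lincomb, (ip_sym N v w).
  assert (Hw1 : e * ip N v v <= ip N w v).
  { rewrite (ip_ext N w (fun n => 1 * quad (2 * r - r ^ 2 / 2) (- 2 * r) (r ^ 2 / 2) v n + e * v n)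
      v v) by (intros; unfold w, quad; ring).
    rewrite ip_lincomb. pose proof (bdf2_form_nonneg N r v Hr). lra. }
  assert (Hw2 : ip N w w <= 42 * ip N v v).
  { eapply Rle_trans; [apply ip_quad_le|].
    apply Rmult_le_compat_r; [apply ip_sq_nonneg|].
    assert (0 <= 2 * r - r ^ 2 / 2 + e <= 3) by nra.
    assert ((2 * r - r ^ 2 / 2 + e) ^ 2 <= 9) by nra.
    assert ((- 2 * r) ^ 2 <= 4) by nra.
    assert (0 <= r ^ 2 <= 1) by nra.
    assert ((r ^ 2 / 2) ^ 2 <= 1) by nra. lra. }
  pose proof (ip_sq_nonneg N v) as Hv.
  assert (Hi : 0 < / c) by (apply Rinv_0_lt_compat; lra).
  assert (Hci : / c * c = 1) by (field; lra).
  assert (Hie : 42 * / c <= e) by nra.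
  set (i := / c) in *. set (V := ip N v v) in *. set (X := ip N w v) in *.
  assert (HiV : 0 <= i * V) by (apply Rmult_le_pos; lra).
  assert (HieV : 0 <= e * V) by (apply Rmult_le_pos; lra).
  assert (HiX : i * (e * V) <= i * X) by (apply Rmult_le_compat_l; lra).
  assert (HiX0 : 0 <= i * (e * V)) by (apply Rmult_le_pos; lra).
  assert (Hsq : i * i * ip N w w <= i * e * V).
  { apply Rle_trans with (i * i * (42 * V)).
    - apply Rmult_le_compat_l; [apply Rmult_le_pos; lra | exact Hw2].
    - replace (i * i * (42 * V)) with ((42 * i) * (i * V)) by ring.
      replace (i * e * V) with (e * (i * V)) by ring.
      apply Rmult_le_compat_r; lra. }
  assert (Hcross : i * (e * V) <= 2 * q * (i * X)).
  { apply Rle_trans with (1 * (i * X)); [lra|]. apply Rmult_le_compat_r; lra. }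
  lra.
Qed.

Lemma ip_quad_pow_le (N : nat) (a b c q : R) (k : nat) (v : nat -> R) :
  (forall u, ip N (quad a b c u) (quad a b c u) <= q ^ 2 * ip N u u) ->
  ip N (quad_pow a b c k v) (quad_pow a b c k v) <= (q ^ k) ^ 2 * ip N v v.
Proof.
  intros H. induction k as [|k IH]; simpl quad_pow.
  - simpl. lra.
  - eapply Rle_trans; [apply H|].
    replace ((q ^ S k) ^ 2 * ip N v v) with (q ^ 2 * ((q ^ k) ^ 2 * ip N v v)) by (simpl; ring).
    apply Rmult_le_compat_l; [apply pow2_ge_0 | exact IH].
Qed.

Lemma conv_lincomb (a b : nat -> R) (x y : R) (v : nat -> R) (n : nat) :
  conv (fun k => x * a k + y * b k) v n = x * conv a v n + y * conv b v n.
Proof.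
  unfold conv. rewrite !scal_sum, <- plus_sum. apply sum_eq. intros; ring.
Qed.

(* All coefficients of [1 - (1 - y)^g] are positive, so the contraction [|Y| <= q] turns
   [(1 - Y)^g] into an operator bounded below by [(1 - q)^g]. *)
Lemma quad_binpoly_form (N : nat) (g a b c q : R) (K : nat) (v : nat -> R) :
  0 < g < 1 -> 0 < q ->
  (forall u, ip N (quad a b c u) (quad a b c u) <= q ^ 2 * ip N u u) ->
  binpoly g K q * ip N v v <= ip N (conv (quad_binpoly g a b c K) v) v.
Proof.
  intros Hg Hq H. induction K as [|K IH].
  - unfold binpoly. simpl. apply Req_le. rewrite gcoef_0, Rmult_1_r, Rmult_1_l.
    apply ip_ext; [|reflexivity]. intro n.
    transitivity (quad_pow a b c 0 v n); [reflexivity|].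
    rewrite quad_pow_conv. apply sum_eq. intros.
    unfold quad_binpoly. simpl. rewrite gcoef_0. ring.
  - assert (E : forall n, conv (quad_binpoly g a b c (S K)) v n
      = 1 * conv (quad_binpoly g a b c K) v n + gcoef g (S K) * quad_pow a b c (S K) v n).
    { intro n. rewrite (quad_pow_conv a b c (S K) v n), <- conv_lincomb.
      apply sum_eq. intros. unfold quad_binpoly. rewrite tech5. ring. }
    rewrite (ip_ext N _ _ _ _ E (fun n => eq_refl)), ip_lincomb.
    unfold binpoly. rewrite tech5. fold (binpoly g K q).
    pose proof (gcoef_neg g K Hg) as Hn.
    assert (Hk : ip N (quad_pow a b c (S K) v) v <= q ^ S K * ip N v v).
    { pose proof (ip_quad_pow_le N a b c q (S K) v H) as Hp.
      set (u := quad_pow a b c (S K) v) in *.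
      assert (Hqk : 0 < q ^ S K) by (apply pow_lt; exact Hq).
      set (s := q ^ S K) in *.
      pose proof (ip_sq_nonneg N (fun n => 1 * u n + (- s) * v n)) as H0.
      rewrite ip_lincomb, (ip_sym N u), (ip_sym N v), !ip_lincomb, (ip_sym N v u) in H0.
      apply Rmult_le_reg_l with s; [exact Hqk|]. nra. }
    nra.
Qed.

Lemma ip_term_le (N n : nat) (u : nat -> R) : (n <= N)%nat -> u n ^ 2 <= ip N u u.
Proof.
  intros Hn. induction N as [|N IH].
  - replace n with 0%nat by lia. unfold ip; simpl; lra.
  - unfold ip. rewrite tech5. fold (ip N u u).
    destruct (Nat.eq_dec n (S N)) as [->|Hne].
    + pose proof (ip_sq_nonneg N u). simpl; lra.
    + assert (Hn' : (n <= N)%nat) by lia. specialize (IH Hn').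
      pose proof (Rle_0_sqr (u (S N))) as H; unfold Rsqr in H. lra.
Qed.

Lemma ip_unit_seq (N : nat) : ip N unit_seq unit_seq = 1.
Proof.
  unfold ip. induction N as [|N IH]; [simpl; ring|]. rewrite tech5, IH. simpl; ring.
Qed.

Lemma quad_pow_0 (a b c : R) (k : nat) : quad_pow a b c k unit_seq 0 = a ^ k.
Proof.
  induction k as [|k IH]; [reflexivity|]. cbn [quad_pow]. unfold quad. rewrite IH. simpl. ring.
Qed.

Lemma quad_scal (a b c x : R) (u : nat -> R) (n : nat) :
  quad a b c (fun m => x * u m) n = x * quad a b c u n.
Proof. unfold quad. destruct n as [|[|n]]; simpl; ring. Qed.

(** [F] holds the coefficients of [c^g] times the truncated series of [(1 - Y)^g], an approximation
    of [d^g] for [d(z) = 3/2 + 2 e - 2 r z + r^2 z^2 / 2]. The recurrence is [z d F' = g z d' F]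
    read coefficientwise, with the truncation residual in [rho]. The lower bound on the form holds
    for the truncated sum itself, so it survives the limit. *)
Lemma bdf2_power_approx (g r e : R) (N : nat) :
  0 < g < 1 -> 0 <= r <= 1 -> 0 < e <= 1 ->
  exists F rho : nat -> R,
    Rabs (F 0%nat - Rpower (3 / 2 + 2 * e) g) <= e /\
    (forall n, (n <= N)%nat -> Rabs (rho n) <= e) /\
    (forall n, (3 / 2 + 2 * e) * (INR n * F n)
       = quad 0 (2 * r) (- (r ^ 2 / 2)) (fun m => INR m * F m) n
         - g * quad 0 (2 * r) (- r ^ 2) F n + rho n) /\
    (forall v, Rpower (bdf2 r + e) g * ip N v v <= ip N (conv F v) v).
Proof.
  intros Hg Hr He.
  set (c := 42 / e + 5). set (q := 1 - (bdf2 r + e) / c).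
  set (y0 := 1 - (3 / 2 + 2 * e) / c). set (y1 := 2 * r / c). set (y2 := - (r ^ 2 / 2) / c).
  assert (Hc : 42 < c).
  { assert (Hc42 : 42 < e * c) by (unfold c; field_simplify; lra). nra. }
  assert (Hd : 0 <= bdf2 r <= 3 / 2) by (unfold bdf2; nra).
  assert (Hq : 0 < q < 1).
  { unfold q. assert (0 < (bdf2 r + e) / c) by (apply Rdiv_lt_0_compat; lra).
    assert ((bdf2 r + e) / c < 1) by (apply Rlt_div_l; lra). lra. }
  assert (Hy : 0 < y0 < 1).
  { unfold y0. assert (0 < (3 / 2 + 2 * e) / c) by (apply Rdiv_lt_0_compat; lra).
    assert ((3 / 2 + 2 * e) / c < 1) by (apply Rlt_div_l; lra). lra. }
  pose proof (Rpower_pos c g) as Hcg. set (cg := Rpower c g) in *.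
  (* The added 1 gives [B <= B^2], so that a bound on a square by [B * (q ^ K)^2] yields [B * q ^ K]
     for the absolute value. *)
  set (B := 3 * (0 ^ 2 + y1 ^ 2 + (2 * y2) ^ 2) + 1).
  assert (HB : 1 <= B).
  { unfold B. pose proof (pow2_ge_0 y1). pose proof (pow2_ge_0 (2 * y2)). lra. }
  (* [K1] makes the residual of the recurrence at most [e]; [K2] below does the same for the error
     of the constant coefficient, where [Y] has the value [y0]. *)
  destruct (pow_lt_1_zero q (proj2 (Rabs_lt_between q 1) ltac:(lra)) (e / (c * cg * B))) as [K1 HK1].
  { apply Rdiv_lt_0_compat; [lra|]. repeat apply Rmult_lt_0_compat; lra. }
  destruct (pow_lt_1_zero y0 (proj2 (Rabs_lt_between y0 1) ltac:(lra)) (e * (1 - y0) / cg)) as [K2 HK2].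
  { apply Rdiv_lt_0_compat; [nra|lra]. }
  set (K := Nat.max K1 K2).
  specialize (HK1 K ltac:(unfold K; lia)). specialize (HK2 K ltac:(unfold K; lia)).
  rewrite Rabs_pos_eq in HK1 by (apply pow_le; lra).
  rewrite Rabs_pos_eq in HK2 by (apply pow_le; lra).
  set (P := quad_binpoly g y0 y1 y2 K). set (eK := quad_pow y0 y1 y2 K unit_seq).
  assert (Hcon : forall M u, ip M (quad y0 y1 y2 u) (quad y0 y1 y2 u) <= q ^ 2 * ip M u u).
  { intros M u. apply ip_quad_contract; assumption. }
  exists (fun n => cg * P n).
  exists (fun n => - (c * cg) * ((INR K - g) * gcoef g K * quad 0 y1 (2 * y2) eK n)).
  split; [|split; [|split]].
  - assert (EP : P 0%nat = binpoly g K y0).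
    { apply sum_eq. intros. rewrite quad_pow_0. reflexivity. }
    rewrite EP. destruct (binpoly_bounds g K y0 Hg) as [L U]; [lra|].
    assert (E : Rpower (3 / 2 + 2 * e) g = cg * Rpower (1 - y0) g).
    { unfold cg. rewrite Rpower_mult_distr by lra. f_equal. unfold y0. field. lra. }
    rewrite E.
    assert (cg * (y0 ^ K / (1 - y0)) <= e).
    { apply Rmult_le_reg_r with ((1 - y0) / cg); [apply Rdiv_lt_0_compat; lra|].
      apply Rle_trans with (y0 ^ K); [|lra]. apply Req_le; field; lra. }
    rewrite <- Rmult_minus_distr_l, Rabs_pos_eq by (apply Rmult_le_pos; lra).
    apply Rle_trans with (cg * (y0 ^ K / (1 - y0))); [|assumption].
    apply Rmult_le_compat_l; lra.
  - intros n Hn.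
    set (x := quad 0 y1 (2 * y2) eK n).
    assert (Hx : Rabs x <= B * q ^ K).
    (* A single coefficient is at most the norm of the sequence, and [Y^K] applied to [unit_seq] has
       norm at most [q ^ K]. *)
    { assert (Hx2 : x ^ 2 <= (B * q ^ K) ^ 2).
      { apply Rle_trans with (B * (q ^ K) ^ 2).
        - eapply Rle_trans; [apply (ip_term_le N n (quad 0 y1 (2 * y2) eK) Hn)|].
          eapply Rle_trans; [apply ip_quad_le|].
          pose proof (ip_quad_pow_le N y0 y1 y2 q K unit_seq (Hcon N)) as HeK.
          rewrite ip_unit_seq, Rmult_1_r in HeK. fold eK in HeK.
          apply Rmult_le_compat; [unfold B in HB; lra | apply ip_sq_nonneg | unfold B; lra | exact HeK].
        - replace ((B * q ^ K) ^ 2) with (B * B * (q ^ K) ^ 2) by ring.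
          apply Rmult_le_compat_r; [apply pow2_ge_0|nra]. }
      rewrite <- (Rabs_pos_eq (B * q ^ K)) by (apply Rmult_le_pos; [lra|apply pow_le; lra]).
      apply Rsqr_le_abs_0. unfold Rsqr. simpl in Hx2. lra. }
    pose proof (gcoef_residue_bounds g K Hg) as Hres.
    rewrite !Rabs_mult, Rabs_Ropp.
    rewrite (Rabs_pos_eq (c * cg)) by (apply Rmult_le_pos; lra).
    rewrite <- Rabs_mult. fold (Rabs x).
    assert (Hk1 : Rabs ((INR K - g) * gcoef g K) <= 1) by (apply Rabs_le; lra).
    apply Rle_trans with (c * cg * (1 * (B * q ^ K))).
    + apply Rmult_le_compat_l; [apply Rmult_le_pos; lra|].
      apply Rmult_le_compat; try apply Rabs_pos; assumption.
    + assert (Hpos : 0 < c * cg * B) by (repeat apply Rmult_lt_0_compat; lra).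
      apply (Rmult_lt_compat_l (c * cg * B)) in HK1; [|exact Hpos].
      replace (c * cg * B * (e / (c * cg * B))) with e in HK1 by (field; lra). lra.
  - intro n. pose proof (quad_binpoly_ode g y0 y1 y2 K n) as E. fold P eK in E.
    assert (E1 : c * (INR n * P n) - c * quad y0 y1 y2 (fun m => INR m * P m) n
      = (3 / 2 + 2 * e) * (INR n * P n)
        - quad 0 (2 * r) (- (r ^ 2 / 2)) (fun m => INR m * P m) n).
    { unfold quad, y0, y1, y2. field. lra. }
    assert (E2 : quad 0 (2 * r) (- r ^ 2) P n = c * quad 0 y1 (2 * y2) P n).
    { unfold quad, y1, y2. field. lra. }
    rewrite (quad_ext _ _ _ (fun m => INR m * (cg * P m)) (fun m => cg * (INR m * P m)))
      by (intro; ring).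
    rewrite !quad_scal, E2.
    set (X := quad 0 y1 (2 * y2) eK n) in *.
    set (Y := quad 0 y1 (2 * y2) P n) in *.
    set (W := quad 0 (2 * r) (- (r ^ 2 / 2)) (fun m => INR m * P m) n) in *.
    set (V := quad y0 y1 y2 (fun m => INR m * P m) n) in *.
    replace ((3 / 2 + 2 * e) * (INR n * (cg * P n)))
      with (cg * (W + c * (INR n * P n - V))) by (rewrite Rmult_minus_distr_l, E1; ring).
    rewrite E. ring.
  - intro v.
    assert (E : forall n, conv (fun n => cg * P n) v n = cg * conv P v n + 0 * conv P v n).
    { intro n. rewrite <- conv_lincomb. apply sum_eq; intros; ring. }
    rewrite (ip_ext N _ _ _ _ E (fun n => eq_refl)), ip_lincomb.
    pose proof (quad_binpoly_form N g y0 y1 y2 q K v Hg (proj1 Hq) (Hcon N)) as Hf.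
    fold P in Hf. destruct (binpoly_bounds g K q Hg) as [L _]; [lra|].
    assert (Eg : Rpower (bdf2 r + e) g = cg * Rpower (1 - q) g).
    { unfold cg, q. replace (1 - (1 - (bdf2 r + e) / c)) with ((bdf2 r + e) / c) by ring.
      rewrite Rpower_mult_distr; [f_equal; field; lra | lra | apply Rdiv_lt_0_compat; lra]. }
    rewrite Eg. pose proof (ip_sq_nonneg N v) as Hv.
    assert (Rpower (1 - q) g * ip N v v <= binpoly g K q * ip N v v)
      by (apply Rmult_le_compat_r; assumption).
    rewrite Rmult_0_l, Rplus_0_r, Rmult_assoc. apply Rmult_le_compat_l; lra.
Qed.

(** * Removing the regularisation *)

Lemma is_lim_seq_shift (F : nat -> nat -> R) (L : nat -> R) (n : nat) :
  (forall k, (k < n)%nat -> is_lim_seq (fun m => F m k) (L k)) ->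
  is_lim_seq (fun m => shift (F m) n) (shift L n) /\
  is_lim_seq (fun m => shift (shift (F m)) n) (shift (shift L) n).
Proof.
  intros H. destruct n as [|[|n]]; simpl; split;
    try apply is_lim_seq_const; apply H; lia.
Qed.

Lemma is_lim_seq_quad0 (b c : R) (F : nat -> nat -> R) (L : nat -> R) (n : nat) :
  (forall k, (k < n)%nat -> is_lim_seq (fun m => F m k) (L k)) ->
  is_lim_seq (fun m => quad 0 b c (F m) n) (quad 0 b c L n).
Proof.
  intros H. destruct (is_lim_seq_shift F L n H) as [H1 H2].
  apply (is_lim_seq_ext (fun m => b * shift (F m) n + c * shift (shift (F m)) n)).
  { intro m; unfold quad; ring. }
  replace (quad 0 b c L n) with (b * shift L n + c * shift (shift L) n) by (unfold quad; ring).
  apply is_lim_seq_plus'; (apply is_lim_seq_mult'; [apply is_lim_seq_const | assumption]).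
Qed.

(** For [n >= 1] the factor [3/2 * n] is nonzero, so the recurrence expresses the coefficient [n]
    continuously through the earlier ones, and convergence propagates by strong induction from
    [n = 0]. *)
Lemma is_lim_seq_recurrence (g r : R) (N : nat) (e : nat -> R) (F rho : nat -> nat -> R)
  (L : nat -> R) :
  (forall m, 0 < e m) -> is_lim_seq e 0 ->
  is_lim_seq (fun m => F m 0%nat) (L 0%nat) ->
  (forall n, (n <= N)%nat -> is_lim_seq (fun m => rho m n) 0) ->
  (forall m n, (3 / 2 + 2 * e m) * (INR n * F m n)
       = quad 0 (2 * r) (- (r ^ 2 / 2)) (fun k => INR k * F m k) n
         - g * quad 0 (2 * r) (- r ^ 2) (F m) n + rho m n) ->
  (forall n, 3 / 2 * (INR n * L n)
       = quad 0 (2 * r) (- (r ^ 2 / 2)) (fun k => INR k * L k) n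
         - g * quad 0 (2 * r) (- r ^ 2) L n) ->
  forall n, (n <= N)%nat -> is_lim_seq (fun m => F m n) (L n).
Proof.
  intros He He0 HF0 Hrho HF HL n.
  induction n as [n IH] using (well_founded_induction Nat.lt_wf_0). intro Hn.
  destruct n as [|n]; [exact HF0|]. set (k := S n) in *.
  assert (Hk : 0 < INR k) by (apply lt_0_INR; unfold k; lia).
  assert (IH' : forall j, (j < k)%nat -> is_lim_seq (fun m => F m j) (L j))
    by (intros; apply IH; lia).
  apply (is_lim_seq_ext (fun m =>
    (quad 0 (2 * r) (- (r ^ 2 / 2)) (fun k => INR k * F m k) k
         - g * quad 0 (2 * r) (- r ^ 2) (F m) k + rho m k) * / ((3 / 2 + 2 * e m) * INR k))).
  { intro m. rewrite <- HF. specialize (He m). field. lra. }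
  replace (Finite (L k)) with (Finite
    ((quad 0 (2 * r) (- (r ^ 2 / 2)) (fun k => INR k * L k) k
         - g * quad 0 (2 * r) (- r ^ 2) L k + 0) * / ((3 / 2 + 2 * 0) * INR k))).
  2:{ f_equal. rewrite Rplus_0_r, <- HL. field. lra. }
  apply is_lim_seq_mult'.
  - apply is_lim_seq_plus'; [apply is_lim_seq_minus'|apply Hrho; exact Hn].
    + apply (is_lim_seq_quad0 _ _ (fun m j => INR j * F m j) (fun j => INR j * L j)).
      intros j Hj. apply is_lim_seq_mult'; [apply is_lim_seq_const|apply IH'; exact Hj].
    + apply is_lim_seq_mult'; [apply is_lim_seq_const|].
      apply is_lim_seq_quad0; exact IH'.
  - apply (is_lim_seq_inv (fun m => (3 / 2 + 2 * e m) * INR k) (Finite ((3 / 2 + 2 * 0) * INR k))).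
    + apply is_lim_seq_mult'; [|apply is_lim_seq_const].
      apply is_lim_seq_plus'; [apply is_lim_seq_const|].
      apply is_lim_seq_mult'; [apply is_lim_seq_const | exact He0].
    + intro E. apply Rbar_finite_eq, Rmult_integral in E. destruct E; lra.
Qed.

Lemma is_lim_seq_sum (F : nat -> nat -> R) (L : nat -> R) (N : nat) :
  (forall n, (n <= N)%nat -> is_lim_seq (fun m => F m n) (L n)) ->
  is_lim_seq (fun m => sum_f_R0 (F m) N) (sum_f_R0 L N).
Proof.
  induction N as [|N IH]; intros H; simpl; [apply H; lia|].
  apply is_lim_seq_plus'; [apply IH; intros; apply H; lia | apply H; lia].
Qed.

Lemma rpow0_incr (x y g : R) : 0 < g -> 0 <= x <= y -> rpow0 x g <= rpow0 y g.
Proof.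
  intros Hg H. unfold rpow0. destruct (Rlt_dec 0 x); destruct (Rlt_dec 0 y); try lra.
  - apply Rle_Rpower_l; lra.
  - apply Rlt_le, Rpower_pos.
Qed.

(** For fixed [N] the form depends on finitely many coefficients, so the coefficientwise limit
    suffices. [rpow0] is needed because [bdf2 1 = 0], where [Rpower] does not take the value 0. *)
Lemma bdf2_power_form (g r : R) (L : nat -> R) (N : nat) (v : nat -> R) :
  0 < g < 1 -> 0 <= r <= 1 ->
  L 0%nat = Rpower (3 / 2) g ->
  (forall n, 3 / 2 * (INR n * L n)
       = quad 0 (2 * r) (- (r ^ 2 / 2)) (fun k => INR k * L k) n
         - g * quad 0 (2 * r) (- r ^ 2) L n) ->
  rpow0 (bdf2 r) g * ip N v v <= ip N (conv L v) v.
Proof.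
  intros Hg Hr HL0 HL.
  set (e := fun m => / (INR m + 1)).
  assert (He : forall m, 0 < e m <= 1).
  { intro m. unfold e. pose proof (pos_INR m). split; [apply Rinv_0_lt_compat; lra|].
    rewrite <- Rinv_1. apply Rinv_le_contravar; lra. }
  assert (He0 : is_lim_seq e 0).
  { apply (is_lim_seq_ext (fun m => / INR (S m))); [intro m; unfold e; rewrite S_INR; reflexivity|].
    apply (is_lim_seq_incr_1 (fun m => / INR m)).
    apply (is_lim_seq_inv INR p_infty); [apply is_lim_seq_INR | discriminate]. }
  set (good := fun (m : nat) (p : (nat -> R) * (nat -> R)) =>
    Rabs (fst p 0%nat - Rpower (3 / 2 + 2 * e m) g) <= e m /\
    (forall n, (n <= N)%nat -> Rabs (snd p n) <= e m) /\
    (forall n, (3 / 2 + 2 * e m) * (INR n * fst p n)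
       = quad 0 (2 * r) (- (r ^ 2 / 2)) (fun k => INR k * fst p k) n
         - g * quad 0 (2 * r) (- r ^ 2) (fst p) n + snd p n) /\
    (forall v, Rpower (bdf2 r + e m) g * ip N v v <= ip N (conv (fst p) v) v)).
  assert (Hex : forall m, exists p, good m p).
  { intro m. destruct (bdf2_power_approx g r (e m) N Hg Hr (He m)) as [F [rho H]].
    exists (F, rho). exact H. }
  set (p := fun m => proj1_sig (constructive_indefinite_description _ (Hex m))).
  assert (Hp : forall m, good m (p m)).
  { intro m. unfold p. apply proj2_sig. }
  assert (Hne : is_lim_seq (fun m => - e m) 0).
  { replace (Finite 0) with (Rbar_opp 0) by (simpl; f_equal; ring). apply is_lim_seq_opp in He0. exact He0. }
  assert (Hsq : forall u : nat -> R, (forall m, Rabs (u m) <= e m) -> is_lim_seq u 0).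
  { intros u Hu. apply (is_lim_seq_le_le (fun m => - e m) u e); [|exact Hne|exact He0].
    intro m. apply Rabs_le_between. apply Hu. }
  assert (Hlim : forall n, (n <= N)%nat -> is_lim_seq (fun m => fst (p m) n) (L n)).
  { apply (is_lim_seq_recurrence g r N e (fun m => fst (p m)) (fun m => snd (p m)) L).
    - intro m; apply He.
    - exact He0.
    - apply (is_lim_seq_ext (fun m => (fst (p m) 0%nat - Rpower (3 / 2 + 2 * e m) g)
                                      + Rpower (3 / 2 + 2 * e m) g)); [intro; ring|].
      rewrite HL0, <- (Rplus_0_l (Rpower (3 / 2) g)).
      apply is_lim_seq_plus'; [apply Hsq; intro m; apply Hp|].
      apply (is_lim_seq_continuous (fun x => Rpower (3 / 2 + 2 * x) g) e 0) in He0.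
      + rewrite Rmult_0_r, Rplus_0_r in He0. exact He0.
      + apply continuity_pt_filterlim.
        apply (ex_derive_continuous (fun x => Rpower (3 / 2 + 2 * x) g)).
        unfold Rpower. auto_derive. lra.
    - intros n Hn. apply Hsq. intro m. apply (Hp m). exact Hn.
    - intros m n. apply (Hp m).
    - exact HL. }
  apply (is_lim_seq_le (fun _ => rpow0 (bdf2 r) g * ip N v v)
    (fun m => ip N (conv (fst (p m)) v) v) (Finite (rpow0 (bdf2 r) g * ip N v v))
    (Finite (ip N (conv L v) v))).
  - intro m. eapply Rle_trans; [|apply (Hp m)].
    apply Rmult_le_compat_r; [apply ip_sq_nonneg|].
    assert (0 <= bdf2 r) by (unfold bdf2; nra). specialize (He m).
    replace (Rpower (bdf2 r + e m) g) with (rpow0 (bdf2 r + e m) g).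
    + apply rpow0_incr; lra.
    + unfold rpow0. destruct (Rlt_dec 0 (bdf2 r + e m)); [reflexivity|lra].
  - apply is_lim_seq_const.
  - apply is_lim_seq_sum. intros n Hn.
    apply is_lim_seq_mult'; [|apply is_lim_seq_const].
    apply is_lim_seq_sum. intros k Hk.
    apply is_lim_seq_mult'; [apply Hlim; lia|apply is_lim_seq_const].
Qed.

(** * Taylor coefficients of the power of the symbol *)

(** Leibniz's rule for the [n]-th derivative of [bdf2 * F' = g * bdf2' * F], where [F = bdf2^g],
    [bdf2' = x - 2] and [bdf2'' = 1]. On [|x| < 1] the symbol is positive, so each new derivative is
    a quotient of differentiable functions. *)
Lemma Derive_n_bdf2_power (g : R) (n : nat) (x : R) : Rabs x < 1 ->
  let D := fun k => Derive_n (fun z => Rpower (bdf2 z) g) k in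
  ex_derive (D n) x /\
  bdf2 x * D (S n) x
  = (g - INR n) * (x - 2) * D n x
    + INR n * (g - (INR n - 1) / 2) * D (pred n) x.
Proof.
  intros Hx D. revert x Hx.
  assert (Hpos : forall x, Rabs x < 1 -> 0 < bdf2 x).
  { intros x Hx. apply Rabs_lt_between in Hx. unfold bdf2. nra. }
  assert (Hd0 : forall x, is_derive bdf2 x (x - 2)).
  { intro x. unfold bdf2. auto_derive; [exact I|]. field. }
  assert (Hloc : forall x, Rabs x < 1 -> locally x (fun t => Rabs t < 1)).
  { intros x Hx.
    apply (open_comp Rabs (fun t => t < 1)); [|apply open_lt|exact Hx].
    intros; apply continuous_Rabs. }
  assert (HS : forall k x, ex_derive (D k) x -> is_derive (D k) x (D (S k) x)).
  { intros k x H. apply Derive_correct. exact H. }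
  (* Differentiability of [D (pred n)] is carried along because the right-hand side is
     differentiated in the next step. At [n = 0] the value [pred 0 = 0] is harmless: its term has
     the factor [INR 0]. *)
  enough (H : forall n,
    (forall x, Rabs x < 1 -> ex_derive (D n) x /\ ex_derive (D (pred n)) x /\
     bdf2 x * D (S n) x
     = (g - INR n) * (x - 2) * D n x
       + INR n * (g - (INR n - 1) / 2) * D (pred n) x)).
  { intros x Hx. destruct (H n x Hx) as [H1 [_ H2]]. split; assumption. }
  clear n. induction n as [|n IH]; intros x Hx.
  - assert (H0 : is_derive (D 0%nat) x (g * (x - 2) * Rpower (bdf2 x) g / bdf2 x)).
    { pose proof (Hpos x Hx) as Hp. change (D 0%nat) with (fun z => Rpower (bdf2 z) g).
      evar_last.
      - apply (is_derive_comp (fun y => Rpower y g) bdf2 x); [|apply Hd0].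
        unfold Rpower. auto_derive; [exact Hp|reflexivity].
      - unfold scal; simpl; unfold mult; simpl. unfold Rpower. field. lra. }
    split; [eexists; exact H0|]. split; [eexists; exact H0|].
    rewrite (is_derive_unique _ _ _ H0 : D 1%nat x = _). pose proof (Hpos x Hx).
    change (D 0%nat x) with (Rpower (bdf2 x) g). simpl. field. lra.
  - destruct (IH x Hx) as [Hn [Hp E]].
    set (num := fun t => (g - INR n) * (t - 2) * D n t
       + INR n * (g - (INR n - 1) / 2) * D (pred n) t).
    assert (Hnum : is_derive num x ((g - INR n) * D n x + (g - INR n) * (x - 2) * D (S n) x
       + INR n * (g - (INR n - 1) / 2) * D (S (pred n)) x)).
    { assert (H0 : is_derive (fun t => (g - INR n) * (t - 2)) x (g - INR n))
        by (auto_derive; [exact I | ring]).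
      unfold num. pose proof (HS _ _ Hn) as H1. pose proof (HS _ _ Hp) as H2.
      evar_last.
      - apply @is_derive_plus.
        + apply (is_derive_mult (fun t => (g - INR n) * (t - 2)) (D n) x (g - INR n) (D (S n) x));
            [exact H0|exact H1|exact Rmult_comm].
        + apply (is_derive_scal (D (pred n)) x (INR n * (g - (INR n - 1) / 2)) _ H2).
      - unfold plus, mult; simpl. ring. }
    assert (Hquot : is_derive (D (S n)) x
      ((((g - INR n) * D n x + (g - INR n) * (x - 2) * D (S n) x
       + INR n * (g - (INR n - 1) / 2) * D (S (pred n)) x) * bdf2 x - num x * (x - 2)) / bdf2 x ^ 2)).
    { apply (is_derive_ext_loc (fun t => num t / bdf2 t)).
      - apply (filter_imp (fun t => Rabs t < 1)); [|apply Hloc, Hx].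
        intros t Ht. destruct (IH t Ht) as [_ [_ Et]]. unfold num. rewrite <- Et.
        pose proof (Hpos t Ht). match goal with |- ?a = ?b => change (@eq R a b) end. field. lra.
      - apply (is_derive_div num bdf2 x _ (x - 2)); [exact Hnum|apply Hd0|]. pose proof (Hpos x Hx). lra. }
    split; [eexists; exact Hquot|]. split; [exact Hn|].
    rewrite (is_derive_unique _ _ _ Hquot : D (S (S n)) x = _).
    unfold num. rewrite <- E. simpl pred. rewrite S_INR.
    assert (Epred : INR n * D (S (pred n)) x = INR n * D n x)
      by (destruct n; [simpl; ring | reflexivity]).
    pose proof (Hpos x Hx).
    replace (INR n * (g - (INR n - 1) / 2) * D (S (pred n)) x)
      with ((g - (INR n - 1) / 2) * (INR n * D n x)) by (rewrite <- Epred; ring).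
    field. lra.
Qed.

Lemma lcoef_0 (g : R) : lcoef g 0 = Rpower (3 / 2) g.
Proof. unfold lcoef. simpl. unfold Rdiv. rewrite Rinv_1, Rmult_1_r. f_equal. field. Qed.

(** The previous recurrence at [x = 0], divided by factorials and scaled by [r^n]: the sequence
    [lcoef g k * r ^ k] represents [delta(r z)^g]. *)
Lemma lcoef_recurrence (g r : R) (n : nat) :
  3 / 2 * (INR n * (lcoef g n * r ^ n))
  = quad 0 (2 * r) (- (r ^ 2 / 2)) (fun k => INR k * (lcoef g k * r ^ k)) n
    - g * quad 0 (2 * r) (- r ^ 2) (fun k => lcoef g k * r ^ k) n.
Proof.
  destruct n as [|n]; [unfold quad; simpl; ring|].
  destruct (Derive_n_bdf2_power g n 0) as [_ E]; [rewrite Rabs_R0; lra|]. cbv zeta in E.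
  set (D := fun k => Derive_n (fun z => Rpower (bdf2 z) g) k 0) in E.
  change (bdf2 0 * D (S n) = (g - INR n) * (0 - 2) * D n
      + INR n * (g - (INR n - 1) / 2) * D (pred n)) in E.
  assert (EL : forall k, D k = lcoef g k * INR (fact k)).
  { intro k. unfold lcoef, D. fold bdf2. field_simplify; [reflexivity|].
    apply INR_fact_neq_0. }
  rewrite !EL in E. replace (bdf2 0) with (3 / 2) in E by (unfold bdf2; field).
  destruct n as [|n].
  - unfold quad. cbn [shift]. simpl in E |- *. apply (f_equal (Rmult r)) in E. lra.
  - unfold quad. cbn [shift]. simpl pred in E.
    rewrite !fact_simpl, !mult_INR in E.
    pose proof (INR_fact_lt_0 n) as Hf. set (h := INR (fact n)) in *.
    set (a := lcoef g (S (S n))) in *. set (b := lcoef g (S n)) in *. set (c := lcoef g n) in *.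
    assert (H1 : 0 < INR (S n)) by (apply lt_0_INR; lia).
    apply (Rmult_eq_reg_l (INR (S n) * h)); [|apply Rgt_not_eq, Rmult_lt_0_compat; assumption].
    assert (E2 : 3 / 2 * INR (S (S n)) * a * (INR (S n) * h)
      = ((g - INR (S n)) * (0 - 2) * b + (g - (INR (S n) - 1) / 2) * c) * (INR (S n) * h)) by lra.
    transitivity (3 / 2 * INR (S (S n)) * a * (INR (S n) * h) * r ^ S (S n)); [ring|].
    rewrite E2. rewrite S_INR. simpl pow. field.
Qed.

(** Two damping factors are needed: [r] contains [lambda + rho * U], while the constant subtracted
    in [l0_2] contains [lambda] alone. As [bdf2] decreases on [[0, 1]], the additional damping from
    [U] only raises the lower bound. *)
Lemma lcoef_form_nonneg (g r r0 : R) (N : nat) (v : nat -> R) :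
  0 < g < 1 -> 0 <= r <= r0 -> r0 <= 1 ->
  rpow0 (bdf2 r0) g * ip N v v <= ip N (conv (fun k => lcoef g k * r ^ k) v) v.
Proof.
  intros Hg Hr Hr0.
  apply Rle_trans with (rpow0 (bdf2 r) g * ip N v v).
  - apply Rmult_le_compat_r; [apply ip_sq_nonneg|].
    apply rpow0_incr; [lra|]. unfold bdf2. nra.
  - apply bdf2_power_form; [exact Hg | lra | rewrite lcoef_0; simpl; ring |].
    intro n. apply lcoef_recurrence.
Qed.

(** * A lower bound for the Gamma function *)

(** The improper integral of a nonnegative function is the supremum of its proper integrals. This
    gives the value of [Gamma_pos] a meaning as a limit and makes it an upper bound for every proper
    integral. *)
Lemma is_RInt_gen_nonneg_bounded (f : R -> R) (B : R) :
  (forall x, 0 < x -> continuous f x) -> (forall x, 0 < x -> 0 <= f x) ->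
  (forall x y, 0 < x -> x <= y -> RInt f x y <= B) ->
  exists l, is_RInt_gen f (at_right 0) (Rbar_locally p_infty) l /\
    forall x y, 0 < x -> x <= y -> RInt f x y <= l.
Proof.
  intros Hc Hf HB.
  assert (Hex : forall x y, 0 < x -> 0 < y -> ex_RInt f x y).
  { intros x y Hx Hy. apply (@ex_RInt_continuous R_CompleteNormedModule). intros z [Hz _]. apply Hc.
    apply Rlt_le_trans with (Rmin x y); [apply Rmin_glb_lt; assumption|exact Hz]. }
  assert (Hmono : forall x' x y y', 0 < x' -> x' <= x -> x <= y -> y <= y' ->
    RInt f x y <= RInt f x' y').
  { intros x' x y y' H1 H2 H3 H4.
    rewrite <- (RInt_Chasles f x' x y') by (apply Hex; lra).
    rewrite <- (RInt_Chasles f x y y') by (apply Hex; lra).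
    unfold plus; simpl.
    assert (0 <= RInt f x' x) by (apply RInt_ge_0; [lra | apply Hex; lra | intros; apply Hf; lra]).
    assert (0 <= RInt f y y') by (apply RInt_ge_0; [lra | apply Hex; lra | intros; apply Hf; lra]).
    lra. }
  destruct (completeness (fun z => exists x y, 0 < x /\ x <= y /\ z = RInt f x y)) as [l [Hub Hl]].
  - exists B. intros z [x [y [H1 [H2 ->]]]]. apply HB; assumption.
  - exists (RInt f 1 1), 1, 1. repeat split; lra.
  - assert (Hle : forall x y, 0 < x -> x <= y -> RInt f x y <= l).
    { intros x y H1 H2. apply Hub. exists x, y. repeat split; assumption. }
    exists l. split; [|exact Hle].
    intros P [eps HP].
    assert (Hex2 : exists x y, 0 < x /\ x <= y /\ l - eps < RInt f x y).
    { apply Classical_Prop.NNPP. intro Hno.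
      assert (l <= l - eps); [|destruct eps as [e He]; simpl in *; lra].
      apply Hl. intros z [x [y [H1 [H2 ->]]]]. apply Rnot_lt_le. intro H3. apply Hno.
      exists x, y. repeat split; assumption. }
    destruct Hex2 as [x0 [y0 [H1 [H2 H3]]]].
    apply (Filter_prod _ _ _ (fun x => 0 < x < x0) (fun y => y0 < y)).
    + exists (mkposreal x0 H1). intros t Ht Ht0.
      unfold ball in Ht; simpl in Ht; unfold AbsRing_ball, abs, minus, plus, opp in Ht; simpl in Ht.
      apply Rabs_lt_between in Ht. lra.
    + exists y0. intros; assumption.
    + intros x y Hx Hy. simpl. exists (RInt f x y). split.
      * apply (RInt_correct f x y). apply Hex; lra.
      * apply HP. unfold ball; simpl; unfold AbsRing_ball, abs, minus, plus, opp; simpl.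
        apply Rabs_lt_between.
        pose proof (Hle x y ltac:(lra) ltac:(lra)).
        pose proof (Hmono x x0 y0 y ltac:(lra) ltac:(lra) ltac:(lra) ltac:(lra)).
        destruct eps as [e He]; simpl in *; lra.
Qed.

Lemma RInt_le_primitive (f H dH : R -> R) (x y : R) :
  0 < x -> x <= y ->
  (forall t, 0 < t -> continuous f t) -> (forall t, 0 < t -> continuous dH t) ->
  (forall t, 0 < t -> is_derive H t (dH t)) -> (forall t, 0 < t -> f t <= dH t) ->
  RInt f x y <= H y - H x.
Proof.
  intros Hx Hxy Hf Hc HH Hle.
  assert (Hpos : forall t, Rmin x y <= t -> 0 < t)
    by (intros t Ht; rewrite Rmin_left in Ht by lra; lra).
  assert (HI : is_RInt dH x y (H y - H x)).
  { apply (is_RInt_derive H dH); intros t [Ht _]; [apply HH | apply Hc]; apply Hpos, Ht. }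
  rewrite <- (is_RInt_unique _ _ _ _ HI).
  apply RInt_le; [exact Hxy | | eexists; exact HI | intros; apply Hle; lra].
  apply (@ex_RInt_continuous R_CompleteNormedModule).
  intros z [Hz _]. apply Hf, Hpos, Hz.
Qed.

Lemma RInt_ge_primitive (f H dH : R -> R) (x y : R) :
  0 < x -> x <= y ->
  (forall t, 0 < t -> continuous f t) -> (forall t, 0 < t -> continuous dH t) ->
  (forall t, 0 < t -> is_derive H t (dH t)) -> (forall t, 0 < t -> dH t <= f t) ->
  H y - H x <= RInt f x y.
Proof.
  intros Hx Hxy Hf Hc HH Hle.
  assert (Hpos : forall t, Rmin x y <= t -> 0 < t)
    by (intros t Ht; rewrite Rmin_left in Ht by lra; lra).
  assert (HI : is_RInt dH x y (H y - H x)).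
  { apply (is_RInt_derive H dH); intros t [Ht _]; [apply HH | apply Hc]; apply Hpos, Ht. }
  rewrite <- (is_RInt_unique _ _ _ _ HI).
  apply RInt_le; [exact Hxy | eexists; exact HI | | intros; apply Hle; lra].
  apply (@ex_RInt_continuous R_CompleteNormedModule).
  intros z [Hz _]. apply Hf, Hpos, Hz.
Qed.

Lemma is_derive_Rpower (a t : R) : 0 < t ->
  is_derive (fun t => Rpower t a) t (a * Rpower t (a - 1)).
Proof.
  intros Ht. unfold Rpower. auto_derive; [exact Ht|].
  replace ((a - 1) * ln t) with (a * ln t + - ln t) by ring.
  rewrite exp_plus, exp_Ropp, exp_ln by exact Ht. field. lra.
Qed.

Lemma continuous_Rpower_exp (a t : R) : 0 < t ->
  continuous (fun t => Rpower t a * exp (- t)) t.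
Proof.
  intros Ht. apply (ex_derive_continuous (fun t => Rpower t a * exp (- t))).
  unfold Rpower. auto_derive. exact Ht.
Qed.

Lemma is_derive_Rpower_exp (a t : R) : 0 < t ->
  is_derive (fun t => Rpower t a * exp (- t)) t
    (a * (Rpower t (a - 1) * exp (- t)) - Rpower t a * exp (- t)).
Proof.
  intros Ht.
  evar_last.
  - apply (is_derive_mult (fun t => Rpower t a) (fun t => exp (- t)) t
      (a * Rpower t (a - 1)) (- exp (- t))); [apply is_derive_Rpower, Ht | | exact Rmult_comm].
    auto_derive; [exact I | ring].
  - unfold plus, mult; simpl. match goal with |- ?x = ?y => change (@eq R x y) end. ring.
Qed.

Lemma exp_ge_1_plus (x : R) : 1 + x <= exp x.
Proof.
  destruct (Req_dec x 0) as [->|Hx]; [rewrite exp_0; lra | apply Rlt_le, exp_ineq1, Hx].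
Qed.

Lemma Rpower_bernoulli (u a : R) : 0 < u -> 0 < a -> 1 - a * (u - 1) <= Rpower u (- a).
Proof.
  intros Hu Ha. unfold Rpower.
  assert (ln u <= u - 1).
  { pose proof (exp_ge_1_plus (ln u)) as H. rewrite exp_ln in H by exact Hu. lra. }
  pose proof (exp_ge_1_plus (- a * ln u)). nra.
Qed.

Lemma Rpower_le_1_plus (t a : R) : 0 < t -> 0 < a < 1 -> Rpower t a <= 1 + t.
Proof.
  intros Ht Ha. destruct (Rle_lt_dec t 1) as [H1|H1].
  - apply Rle_trans with (exp 0); [|rewrite exp_0; lra].
    unfold Rpower. apply exp_incr.
    assert (ln t <= 0) by (rewrite <- ln_1; apply Rcomplements.ln_le; lra). nra.
  - apply Rle_trans with (Rpower t 1); [apply Rle_Rpower; lra|]. rewrite Rpower_1; lra.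
Qed.

Lemma Gamma_pos_bounds (a : R) : 0 < a < 1 ->
  exists l, Gamma_pos (1 - a) = l /\ forall x y, 0 < x -> x <= y ->
    RInt (fun t => Rpower t (- a) * exp (- t)) x y <= l.
Proof.
  intros Ha.
  destruct (is_RInt_gen_nonneg_bounded (fun t => Rpower t (- a) * exp (- t)) (2 / (1 - a)))
    as [l [Hl Hle]].
  - intros x Hx. apply continuous_Rpower_exp, Hx.
  - intros x Hx. apply Rmult_le_pos; apply Rlt_le; apply exp_pos.
  - intros x y Hx Hxy.
    (* One integration by parts removes the singularity at 0; the remaining [t^(1-a) e^(-t)] is
       dominated by [(1 + t) e^(-t)], which has the primitive [-(2 + t) e^(-t)]. *)
    set (H := fun t => (Rpower t (1 - a) * exp (- t) - (2 + t) * exp (- t)) / (1 - a)).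
    eapply Rle_trans.
    + apply (RInt_le_primitive _ H (fun t => Rpower t (- a) * exp (- t)
         + ((1 + t) * exp (- t) - Rpower t (1 - a) * exp (- t)) / (1 - a)) x y Hx Hxy).
      * intros t Ht. apply continuous_Rpower_exp, Ht.
      * intros t Ht.
        apply (ex_derive_continuous (fun t => Rpower t (- a) * exp (- t)
         + ((1 + t) * exp (- t) - Rpower t (1 - a) * exp (- t)) / (1 - a))).
        unfold Rpower. auto_derive. repeat split; exact Ht.
      * intros t Ht. unfold H.
        assert (H0 : is_derive (fun t => (2 + t) * exp (- t)) t (- (1 + t) * exp (- t)))
          by (auto_derive; [exact I | ring]).
        pose proof (is_derive_Rpower_exp (1 - a) t Ht) as H1.
        replace (1 - a - 1) with (- a) in H1 by ring.
        apply (is_derive_ext (fun t => / (1 - a) * (Rpower t (1 - a) * exp (- t) - (2 + t) * exp (- t)))).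
        { intro s. match goal with |- ?x = ?y => change (@eq R x y) end. field. lra. }
        evar_last.
        { apply is_derive_scal. apply (@is_derive_minus R_AbsRing R_NormedModule _ _ _ _ _ H1 H0). }
        unfold minus, plus, opp, scal; simpl.
        match goal with |- ?x = ?y => change (@eq R x y) end. field. lra.
      * intros t Ht. cbv beta.
        pose proof (Rpower_le_1_plus t (1 - a) Ht ltac:(lra)).
        assert (0 <= ((1 + t) * exp (- t) - Rpower t (1 - a) * exp (- t)) / (1 - a)); [|lra].
        apply Rdiv_le_0_compat; [|lra]. pose proof (exp_pos (- t)). nra.
    + unfold H. unfold Rdiv. rewrite <- Rmult_minus_distr_r.
      apply Rmult_le_compat_r; [apply Rlt_le, Rinv_0_lt_compat; lra|].
      pose proof (Rpower_le_1_plus y (1 - a) ltac:(lra) ltac:(lra)).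
      pose proof (exp_pos (- y)). pose proof (Rpower_pos x (1 - a)).
      pose proof (exp_pos (- x)).
      assert (Rpower y (1 - a) * exp (- y) <= (2 + y) * exp (- y))
        by (apply Rmult_le_compat_r; lra).
      assert (0 <= Rpower x (1 - a) * exp (- x)) by (apply Rmult_le_pos; lra).
      assert ((2 + x) * exp (- x) <= 2).
      { pose proof (exp_ge_1_plus x). rewrite exp_Ropp.
        apply Rmult_le_reg_r with (exp x); [apply exp_pos|].
        rewrite Rmult_assoc, Rinv_l by (pose proof (exp_pos x); lra). lra. }
      lra.
  - exists l. split; [|exact Hle].
    unfold Gamma_pos. replace (1 - a - 1) with (- a) by ring.
    apply (is_RInt_gen_unique (V := R_CompleteNormedModule)). exact Hl.
Qed.

(** The product of [j - a] for [j] from 1 to [k], that is, [Gamma(k + 1 - a) / Gamma(1 - a)]. *)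
Fixpoint shifted_fact (a : R) (k : nat) : R :=
  match k with O => 1 | S k' => shifted_fact a k' * (INR (S k') - a) end.

Lemma shifted_fact_pos (a : R) (k : nat) : a < 1 -> 0 < shifted_fact a k.
Proof.
  intros Ha. induction k as [|k IH]; cbn [shifted_fact]; [lra|].
  apply Rmult_lt_0_compat; [exact IH|]. rewrite S_INR. pose proof (pos_INR k). lra.
Qed.

(** The functional equation of Gamma iterated [k] times, kept as a primitive: [Q] collects the
    boundary terms of the integrations by parts. Only its sign at large [t] and its decay like
    [t^(1-a)] at 0 are used later. *)
Lemma shifted_fact_primitive (a : R) (k : nat) : 0 < a < 1 ->
  exists (Q : R -> R) (C : R), 0 <= C /\ forall t, 0 < t ->
    is_derive Q t (shifted_fact a k * (Rpower t (- a) * exp (- t))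
                   - Rpower t (INR k - a) * exp (- t)) /\ 0 <= Q t /\ (t <= 1 -> Q t <= C * Rpower t (1 - a)).
Proof.
  intros Ha. induction k as [|k [Q [C [HC HQ]]]].
  - exists (fun _ => 0), 0. split; [lra|]. intros t Ht. split; [|split; intros; lra].
    evar_last; [apply @is_derive_const|]. simpl. replace (0 - a) with (- a) by ring.
    unfold zero; simpl. ring.
  - set (x := INR (S k) - a).
    assert (Hx : 1 - a <= x) by (unfold x; rewrite S_INR; pose proof (pos_INR k); lra).
    exists (fun t => x * Q t + Rpower t x * exp (- t)), (x * C + 1).
    split; [nra|]. intros t Ht. destruct (HQ t Ht) as [H1 [H2 H3]].
    pose proof (exp_pos (- t)) as He. pose proof (Rpower_pos t x) as Hp.
    split; [|split].
    + pose proof (is_derive_Rpower_exp x t Ht) as H4.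
      evar_last.
      { apply @is_derive_plus; [apply (is_derive_scal Q t x _ H1)|exact H4]. }
      unfold plus; simpl plus. cbn [shifted_fact]. fold x.
      replace (INR k - a) with (x - 1) by (unfold x; rewrite S_INR; ring).
      unfold scal; simpl. match goal with |- ?x = ?y => change (@eq R x y) end. ring.
    + apply Rplus_le_le_0_compat; apply Rmult_le_pos; lra.
    + intro Ht1. specialize (H3 Ht1).
      assert (Rpower t x <= Rpower t (1 - a)).
      { unfold Rpower. apply exp_incr.
        assert (ln t <= 0) by (rewrite <- ln_1; apply Rcomplements.ln_le; lra). nra. }
      assert (exp (- t) <= 1) by (rewrite <- exp_0; apply exp_incr; lra).
      assert (x * Q t <= x * (C * Rpower t (1 - a))) by (apply Rmult_le_compat_l; lra).
      assert (Rpower t x * exp (- t) <= Rpower t (1 - a) * 1) by (apply Rmult_le_compat; lra).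
      lra.
Qed.

(** Raise [t / (k + 1) <= exp (t / (k + 1))] to the power [k + 1]. The bound controls boundary terms
    at infinity. *)
Lemma pow_exp_le (k : nat) (t : R) : 0 < t ->
  t ^ k * exp (- t) <= INR (S k) ^ S k / t.
Proof.
  intros Ht.
  assert (Hk : 0 < INR (S k)) by (apply lt_0_INR; lia).
  assert (H : t ^ S k <= INR (S k) ^ S k * exp t).
  { replace t with (INR (S k) * (t / INR (S k))) at 1 by (field; lra).
    rewrite Rpow_mult_distr. apply Rmult_le_compat_l; [apply pow_le; lra|].
    replace (exp t) with (exp (t / INR (S k)) ^ S k).
    - apply pow_incr. split; [apply Rlt_le, Rdiv_lt_0_compat; lra|].
      pose proof (exp_ge_1_plus (t / INR (S k))). lra.
    - rewrite <- Rpower_pow by apply exp_pos. unfold Rpower. rewrite ln_exp.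
      f_equal. field. lra. }
  apply Rmult_le_reg_r with (t * exp t); [apply Rmult_lt_0_compat; [lra|apply exp_pos]|].
  rewrite exp_Ropp. pose proof (exp_pos t).
  replace (t ^ k * / exp t * (t * exp t)) with (t ^ S k) by (simpl; field; lra).
  replace (INR (S k) ^ S k / t * (t * exp t)) with (INR (S k) ^ S k * exp t) by (field; lra).
  exact H.
Qed.

Lemma is_derive_pow_exp (k : nat) (t : R) :
  is_derive (fun t => t ^ S k * exp (- t)) t
    (INR (S k) * (t ^ k * exp (- t)) - t ^ S k * exp (- t)).
Proof.
  evar_last.
  - apply (is_derive_mult (fun t => t ^ S k) (fun t => exp (- t)) t
      (INR (S k) * 1 * t ^ k) (- exp (- t))); [| | exact Rmult_comm].
    + apply (is_derive_pow (fun t => t) (S k) t 1). apply @is_derive_id.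
    + auto_derive; [exact I | ring].
  - unfold plus, mult; cbn -[INR pow]. match goal with |- ?x = ?y => change (@eq R x y) end. ring.
Qed.

(** The integral of [t^k e^(-t)] over the half-line is [k!]; the two bounds on the primitive give
    the inequality needed here, with [E] near [- k!] or below at 0 and not below [- C / t] at
    infinity. *)
Lemma fact_primitive (k : nat) :
  exists (E : R -> R) (C : R), forall t, 0 < t ->
    is_derive E t (t ^ k * exp (- t)) /\ E t <= - INR (fact k) * exp (- t) /\ - (C / t) <= E t.
Proof.
  induction k as [|k [E [C HE]]].
  - exists (fun t => - exp (- t)), 1. intros t Ht. split; [|split].
    + auto_derive; [exact I | simpl; ring].
    + simpl. lra.
    + pose proof (pow_exp_le 0 t Ht) as H. simpl in H. lra.
  - exists (fun t => INR (S k) * E t - t ^ S k * exp (- t)),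
      (INR (S k) * C + INR (S (S k)) ^ S (S k)).
    intros t Ht. destruct (HE t Ht) as [H1 [H2 H3]].
    assert (Hk : 0 < INR (S k)) by (apply lt_0_INR; lia).
    split; [|split].
    + evar_last.
      { apply @is_derive_minus; [apply (is_derive_scal E t (INR (S k)) _ H1)
        | apply is_derive_pow_exp]. }
      unfold minus, plus, opp, scal; cbn -[INR pow].
      match goal with |- ?x = ?y => change (@eq R x y) end. ring.
    + rewrite fact_simpl, mult_INR.
      assert (0 <= t ^ S k * exp (- t))
        by (apply Rmult_le_pos; [apply pow_le; lra | apply Rlt_le, exp_pos]).
      assert (INR (S k) * E t <= INR (S k) * (- INR (fact k) * exp (- t)))
        by (apply Rmult_le_compat_l; lra).
      lra.
    + pose proof (pow_exp_le (S k) t Ht) as H.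
      assert (INR (S k) * - (C / t) <= INR (S k) * E t) by (apply Rmult_le_compat_l; lra).
      replace ((INR (S k) * C + INR (S (S k)) ^ S (S k)) / t)
        with (INR (S k) * (C / t) + INR (S (S k)) ^ S (S k) / t) by (field; lra).
      lra.
Qed.

(* [Gamma(m - a) >= m^(-a) Gamma(m)] with [m = k + 1]: Jensen's inequality for the density
   [t^k e^(-t)], whose mean is [m], applied through the tangent of [t^(-a)] at [m]. *)
Lemma Gamma_pos_shifted_fact (a : R) (k : nat) : 0 < a < 1 ->
  Rpower (INR (S k)) (- a) * INR (fact k) <= Gamma_pos (1 - a) * shifted_fact a k.
Proof.
  intros Ha. destruct (Gamma_pos_bounds a Ha) as [l [-> Hl]].
  destruct (shifted_fact_primitive a k Ha) as [Q [C [HC HQ]]].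
  destruct (fact_primitive k) as [E [D HE]].
  set (m := INR (S k)). set (ma := Rpower m (- a)). set (P := shifted_fact a k).
  assert (HP : 0 < P) by (apply shifted_fact_pos; lra).
  assert (Hm : 1 <= m) by (unfold m; rewrite S_INR; pose proof (pos_INR k); lra).
  assert (Hma : 0 < ma <= 1).
  { split; [apply Rpower_pos|]. unfold ma, Rpower. rewrite <- exp_0. apply exp_incr.
    assert (0 <= ln m) by (rewrite <- ln_1; apply Rcomplements.ln_le; lra). nra. }
  (* A primitive of the integrand with [t^(-a)] replaced by its tangent at [m] in the term
     [t^(k-a) e^(-t)]. The linear part of the tangent is the derivative of [t^(k+1) e^(-t)] up to a
     factor, so it leaves only boundary terms: this is where the mean [m] enters. *)
  set (H := fun t => / P * (Q t + ma * (E t + a / m * (t ^ S k * exp (- t))))).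
  set (dH := fun t => / P * (P * (Rpower t (- a) * exp (- t)) - Rpower t (INR k - a) * exp (- t)
     + ma * (t ^ k * exp (- t) + a / m * (m * (t ^ k * exp (- t)) - t ^ S k * exp (- t))))).
  assert (HdH : forall t, 0 < t -> is_derive H t (dH t)).
  { intros t Ht. unfold H, dH. apply is_derive_scal.
    apply @is_derive_plus; [apply HQ, Ht|]. apply is_derive_scal.
    apply @is_derive_plus; [apply HE, Ht|]. apply is_derive_scal. apply is_derive_pow_exp. }
  assert (Hle : forall t, 0 < t -> dH t <= Rpower t (- a) * exp (- t)).
  { intros t Ht. unfold dH.
    assert (Hb : ma * (1 - a * (t / m - 1)) <= Rpower t (- a)).
    { replace (Rpower t (- a)) with (ma * Rpower (t / m) (- a)).
      - apply Rmult_le_compat_l; [lra|]. apply Rpower_bernoulli; [|lra].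
        apply Rdiv_lt_0_compat; lra.
      - unfold ma. rewrite Rpower_mult_distr; [f_equal; field; lra | lra |].
        apply Rdiv_lt_0_compat; lra. }
    assert (Hsplit : Rpower t (INR k - a) = t ^ k * Rpower t (- a)).
    { rewrite <- Rpower_pow by exact Ht. rewrite <- Rpower_plus. f_equal. }
    assert (Htk : 0 <= t ^ k * exp (- t))
      by (apply Rmult_le_pos; [apply pow_le; lra | apply Rlt_le, exp_pos]).
    apply (Rmult_le_compat_l (t ^ k * exp (- t))) in Hb; [|exact Htk].
    apply Rmult_le_reg_l with P; [exact HP|].
    rewrite <- Rmult_assoc, Rinv_r, Rmult_1_l by lra. rewrite Hsplit.
    replace (ma * (t ^ k * exp (- t) + a / m * (m * (t ^ k * exp (- t)) - t ^ S k * exp (- t))))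
      with (t ^ k * exp (- t) * (ma * (1 - a * (t / m - 1)))) by (simpl; field; lra).
    lra. }
  assert (Hxy : forall x y, 0 < x -> x <= y -> H y - H x <= l).
  { intros x y Hx Hxy. apply Rle_trans with (2 := Hl x y Hx Hxy).
    apply (RInt_ge_primitive _ H dH x y Hx Hxy).
    - intros t Ht. apply continuous_Rpower_exp, Ht.
    - intros t Ht. apply (ex_derive_continuous dH). unfold dH, Rpower.
      auto_derive. repeat split; exact Ht.
    - exact HdH.
    - exact Hle. }
  set (L := ma * INR (fact k)).
  assert (HL : 0 < L) by (apply Rmult_lt_0_compat; [lra | apply INR_fact_lt_0]).
  (* Boundary losses on [[x, y]]: with [x^(1-a) = s] the terms at [x] cost at most
     [s * (L + C + 1)], and [y = 1 + |D| / d] makes the term at [y] cost at most [d]. *)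
  assert (Hs : forall s d, 0 < s <= 1 -> 0 < d -> L - s * (L + C + 1) - d <= l * P).
  { intros s d Hs Hd.
    set (x := Rpower s (/ (1 - a))).
    assert (Hx : 0 < x <= s).
    { split; [apply Rpower_pos|]. rewrite <- (Rpower_1 s) by lra. unfold x, Rpower.
      apply exp_incr.
      assert (ln s <= 0) by (rewrite <- ln_1; apply Rcomplements.ln_le; lra).
      assert (1 <= / (1 - a)) by (rewrite <- Rinv_1; apply Rinv_le_contravar; lra). nra. }
    assert (Hxa : Rpower x (1 - a) = s).
    { unfold x. rewrite Rpower_mult. replace (/ (1 - a) * (1 - a)) with 1 by (field; lra).
      apply Rpower_1; lra. }
    set (y := 1 + Rabs D / d).
    assert (HDd : 0 <= Rabs D / d) by (apply Rdiv_le_0_compat; [apply Rabs_pos | exact Hd]).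
    assert (Hy : 1 <= y) by (unfold y; lra).
    destruct (HE y) as [_ [_ Ey]]; [lra|]. destruct (HE x) as [_ [Ex _]]; [lra|].
    destruct (HQ y) as [_ [Qy _]]; [lra|]. destruct (HQ x) as [_ [_ Qx]]; [lra|].
    specialize (Qx ltac:(lra)). rewrite Hxa in Qx.
    assert (HDy : D / y <= d).
    { apply Rle_div_l; [lra|]. pose proof (Rle_abs D).
      replace (d * y) with (d + Rabs D) by (unfold y; field; lra). lra. }
    pose proof (Hxy x y (proj1 Hx) ltac:(lra)) as Hi. unfold H in Hi.
    rewrite <- Rmult_minus_distr_l in Hi.
    apply (Rmult_le_compat_r P) in Hi; [|lra].
    match type of Hi with / P * ?z * P <= _ =>
      replace (/ P * z * P) with z in Hi by (field; lra) end.
    assert (Ham : 0 <= a / m <= 1).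
    { split; [apply Rdiv_le_0_compat; lra|]. apply Rle_div_l; lra. }
    assert (0 <= y ^ S k * exp (- y))
      by (apply Rmult_le_pos; [apply pow_le; lra | apply Rlt_le, exp_pos]).
    assert (0 <= a / m * (y ^ S k * exp (- y))) by (apply Rmult_le_pos; lra).
    assert (Hxk : 0 <= x ^ S k * exp (- x) <= s).
    { assert (0 <= x ^ k <= 1) by (split; [apply pow_le; lra|];
        rewrite <- (pow1 k); apply pow_incr; lra).
      assert (0 < exp (- x) <= 1) by (split; [apply exp_pos|];
        rewrite <- exp_0; apply exp_incr; lra).
      simpl. split; [apply Rmult_le_pos; nra|].
      apply Rle_trans with (x * x ^ k * 1); [apply Rmult_le_compat_l; nra | nra]. }
    assert (Hax : a / m * (x ^ S k * exp (- x)) <= s).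
    { apply Rle_trans with (1 * (x ^ S k * exp (- x))); [apply Rmult_le_compat_r; lra|lra]. }
    assert (Hex : 1 - s <= exp (- x)) by (pose proof (exp_ge_1_plus (- x)); lra).
    pose proof (INR_fact_lt_0 k) as Hf.
    assert (Ex' : E x <= - INR (fact k) * (1 - s)) by nra.
    assert (ma * - d <= ma * (E y + a / m * (y ^ S k * exp (- y))))
      by (apply Rmult_le_compat_l; lra).
    assert (ma * (E x + a / m * (x ^ S k * exp (- x))) <= ma * (- INR (fact k) * (1 - s) + s))
      by (apply Rmult_le_compat_l; lra).
    assert (ma * d <= d) by nra. assert (ma * s <= s) by nra.
    unfold L. lra. }
  apply Rnot_lt_le. intro Hlt. fold L in Hlt.
  set (g := L - l * P) in *. assert (Hg : 0 < g) by (unfold g; lra).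
  set (W := L + C + 1) in *. assert (HW : 0 < W) by (unfold W; lra).
  (* If the claim failed by [g > 0], each of the two losses could be made at most [g / 4], a
     contradiction. *)
  set (s := Rmin 1 (g / (4 * W))).
  assert (Hs1 : 0 < s) by (apply Rmin_glb_lt; [lra | apply Rdiv_lt_0_compat; lra]).
  assert (Hs2 : s <= 1) by apply Rmin_l.
  assert (Hs3 : s * W <= g / 4).
  { apply Rle_trans with (g / (4 * W) * W); [apply Rmult_le_compat_r; [lra | apply Rmin_r]|].
    apply Req_le; field; lra. }
  specialize (Hs s (g / 4) (conj Hs1 Hs2) ltac:(lra)). unfold g in *. lra.
Qed.

(** * The spatial form *)

Lemma gcoef_pascal (al : R) (m : nat) :
  gcoef al (S m) = gcoef (al - 1) (S m) - gcoef (al - 1) m.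
Proof.
  induction m as [|m IH].
  - rewrite !gcoef_S_div, !gcoef_0. simpl. field.
  - rewrite (gcoef_S_div al), IH, (gcoef_S_div (al - 1) (S m)).
    rewrite (gcoef_S_div (al - 1) m). rewrite !S_INR.
    pose proof (pos_INR m). field. split; lra.
Qed.

Definition wsum (al : R) (m : nat) : R := sum_f_R0 (wcoef al) m.

(** The weights are generated by [(al/2 + (2 - al)/2 * z) * (1 - z)^al]; taking partial sums divides
    by [1 - z] and lowers the order of the binomial coefficients to [al - 1]. *)
Lemma wsum_S (al : R) (m : nat) :
  wsum al (S m) = al / 2 * gcoef (al - 1) (S m) + (2 - al) / 2 * gcoef (al - 1) m.
Proof.
  induction m as [|m IH].
  - unfold wsum. cbn [sum_f_R0 wcoef]. rewrite (gcoef_pascal al 0), !gcoef_0. field.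
  - unfold wsum. rewrite tech5. fold (wsum al (S m)). rewrite IH.
    cbn [wcoef]. rewrite (gcoef_pascal al (S m)), (gcoef_pascal al m). field.
Qed.

Lemma gcoef_shifted_fact (a : R) (k : nat) :
  - gcoef a (S k) = a * shifted_fact a k / INR (fact (S k)).
Proof.
  induction k as [|k IH].
  - rewrite gcoef_S_div, gcoef_0. simpl. field.
  - rewrite gcoef_S_div.
    replace (- ((INR (S k) - a) * gcoef a (S k) / INR (S (S k))))
      with ((INR (S k) - a) * (- gcoef a (S k)) / INR (S (S k))).
    2:{ field. apply not_0_INR; lia. }
    rewrite IH, (fact_simpl (S k)), mult_INR. cbn [shifted_fact].
    field. split; [apply INR_fact_neq_0 | apply not_0_INR; lia].
Qed.

Lemma Gamma_reflect (al : R) : 1 < al < 2 ->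
  Rabs (Gamma (1 - al)) = Gamma_pos (1 - (al - 1)) / (al - 1) /\
  0 < Gamma_pos (1 - (al - 1)).
Proof.
  intros Hal.
  assert (Hpos : 0 < Gamma_pos (1 - (al - 1))).
  { pose proof (Gamma_pos_shifted_fact (al - 1) 0 ltac:(lra)) as H.
    simpl in H. pose proof (Rpower_pos 1 (- (al - 1))). lra. }
  split; [|exact Hpos].
  unfold Gamma. destruct (Rlt_dec 0 (1 - al)); [lra|].
  replace (1 - al + 1) with (1 - (al - 1)) by ring.
  unfold Rdiv. rewrite Rabs_mult, (Rabs_pos_eq (Gamma_pos _)) by lra.
  rewrite Rabs_inv, Rabs_left by lra. f_equal. f_equal. ring.
Qed.

(** With [a = al - 1] and [m = k + 1], the right side is [Gamma(m - a) / (m! |Gamma(1 - al)|)], so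
    the Gamma bound gives [m^(-a) / m = m^(-al)]. *)
Lemma gcoef_Gamma_le (al : R) (k : nat) : 1 < al < 2 ->
  Rpower (INR (S k)) (- al) / Rabs (Gamma (1 - al)) <= - gcoef (al - 1) (S k).
Proof.
  intros Hal. destruct (Gamma_reflect al Hal) as [E Hpos].
  pose proof (Gamma_pos_shifted_fact (al - 1) k ltac:(lra)) as H.
  rewrite E, gcoef_shifted_fact. set (Ga := Gamma_pos (1 - (al - 1))) in *.
  assert (Hk : 0 < INR (S k)) by (apply lt_0_INR; lia).
  replace (Rpower (INR (S k)) (- al)) with (Rpower (INR (S k)) (- (al - 1)) * / INR (S k)).
  2:{ rewrite <- (Rpower_1 (INR (S k))) at 2 by exact Hk.
      rewrite <- Rpower_Ropp, <- Rpower_plus. f_equal. ring. }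
  pose proof (INR_fact_lt_0 k) as Hf.
  rewrite fact_simpl, mult_INR.
  apply Rmult_le_reg_r with (Ga * INR (S k) * INR (fact k) / (al - 1)).
  { apply Rdiv_lt_0_compat; [|lra]. repeat apply Rmult_lt_0_compat; assumption. }
  match goal with |- ?a <= ?b =>
    replace a with (Rpower (INR (S k)) (- (al - 1)) * INR (fact k)) by (field; lra);
    replace b with (Ga * shifted_fact (al - 1) k) by (field; lra) end.
  exact H.
Qed.

(** For [m >= 2] the partial sum is a convex combination of two consecutive negative coefficients.
    These increase with the index, so the last one bounds it; at [m = 1] the positive coefficient of
    index 0 would enter. *)
Lemma wsum_le (al : R) (m M : nat) : 1 < al < 2 -> (2 <= m <= M)%nat ->
  wsum al m <= - (Rpower (INR M) (- al) / Rabs (Gamma (1 - al))).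
Proof.
  intros Hal Hm. destruct m as [|[|m]]; [lia|lia|].
  rewrite wsum_S.
  pose proof (gcoef_Gamma_le al (S m) Hal) as H.
  assert (Hle : Rpower (INR M) (- al) / Rabs (Gamma (1 - al))
     <= Rpower (INR (S (S m))) (- al) / Rabs (Gamma (1 - al))).
  { apply Rmult_le_compat_r.
    - destruct (Gamma_reflect al Hal) as [E Hpos]. rewrite E.
      apply Rlt_le, Rinv_0_lt_compat, Rdiv_lt_0_compat; lra.
    - unfold Rpower. apply exp_incr.
      assert (ln (INR (S (S m))) <= ln (INR M)).
      { apply Rcomplements.ln_le; [apply lt_0_INR; lia | apply le_INR; lia]. }
      nra. }
  pose proof (gcoef_neg (al - 1) m ltac:(lra)) as Hn.
  assert (Hmono : gcoef (al - 1) (S m) <= gcoef (al - 1) (S (S m))).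
  { apply Rmult_le_reg_r with (INR (S (S m))); [apply lt_0_INR; lia|].
    rewrite (gcoef_S (al - 1) (S m)), (S_INR (S m)). nra. }
  nra.
Qed.

Lemma gcoef_nonneg (al : R) (k : nat) : 1 < al < 2 -> 0 <= gcoef al (S (S k)).
Proof.
  intros Hal. induction k as [|k IH].
  - rewrite !gcoef_S_div, gcoef_0. simpl. apply Rdiv_le_0_compat; nra.
  - rewrite gcoef_S_div. apply Rdiv_le_0_compat; [|apply lt_0_INR; lia].
    apply Rmult_le_pos; [|exact IH]. rewrite !S_INR. pose proof (pos_INR k). lra.
Qed.

Lemma wcoef_nonneg (al : R) (k : nat) : 1 < al < 2 -> 0 <= wcoef al (S (S (S k))).
Proof.
  intros Hal. cbn [wcoef].
  apply Rplus_le_le_0_compat; apply Rmult_le_pos; try lra; apply gcoef_nonneg, Hal.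
Qed.

(** [wcoef al 2] can be negative for [al] near 1; symmetrisation pairs it with [wcoef al 0], and the
    sum factors as [al/4 * (al + 2) * (al - 1)]. *)
Lemma wcoef_02_nonneg (al : R) : 1 < al < 2 -> 0 <= wcoef al 0 + wcoef al 2.
Proof.
  intros Hal. cbn [wcoef]. rewrite !gcoef_S_div, gcoef_0. simpl.
  match goal with |- 0 <= ?a => replace a with (al / 4 * (al + 2) * (al - 1)) by field end.
  apply Rmult_le_pos; nra.
Qed.

(* [wmat] is the Grunwald matrix plus its transpose. *)
Definition gmat (al : R) (i j : nat) : R :=
  if Nat.leb j (S i) then wcoef al (S i - j) else 0.

Lemma wmat_gmat (al : R) (i j : nat) : wmat al i j = gmat al i j + gmat al j i.
Proof.
  unfold wmat, gmat.
  destruct (Nat.ltb_spec (j + 1) i).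
  { rewrite (proj2 (Nat.leb_le j (S i))) by lia.
    rewrite (proj2 (Nat.leb_gt i (S j))) by lia.
    replace (i - j + 1)%nat with (S i - j)%nat by lia. ring. }
  destruct (Nat.eqb_spec (j + 1) i).
  { subst i. cbn [orb]. rewrite (proj2 (Nat.leb_le j _)) by lia.
    rewrite (proj2 (Nat.leb_le (j + 1) _)) by lia.
    replace (S (j + 1) - j)%nat with 2%nat by lia.
    replace (S j - (j + 1))%nat with 0%nat by lia. ring. }
  cbn [orb].
  destruct (Nat.eqb_spec j (i + 1)).
  { subst j. rewrite (proj2 (Nat.leb_le (i + 1) _)) by lia.
    rewrite (proj2 (Nat.leb_le i _)) by lia.
    replace (S i - (i + 1))%nat with 0%nat by lia.
    replace (S (i + 1) - i)%nat with 2%nat by lia. ring. }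
  destruct (Nat.eqb_spec j i).
  { subst j. rewrite (proj2 (Nat.leb_le i _)) by lia.
    replace (S i - i)%nat with 1%nat by lia. ring. }
  rewrite (proj2 (Nat.leb_gt j _)) by lia. rewrite (proj2 (Nat.leb_le i _)) by lia.
  replace (j - i + 1)%nat with (S j - i)%nat by lia. ring.
Qed.

Lemma wmat_sym (al : R) (i j : nat) : wmat al i j = wmat al j i.
Proof. rewrite !wmat_gmat. ring. Qed.

Lemma wmat_off_diag_nonneg (al : R) (i j : nat) : 1 < al < 2 -> i <> j -> 0 <= wmat al i j.
Proof.
  intros Hal Hij. unfold wmat.
  destruct (Nat.ltb_spec (j + 1) i).
  { replace (i - j + 1)%nat with (S (S (S (i - j - 2)))) by lia. apply wcoef_nonneg, Hal. }
  destruct (Nat.eqb_spec (j + 1) i); [apply wcoef_02_nonneg, Hal|].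
  destruct (Nat.eqb_spec j (i + 1)); [apply wcoef_02_nonneg, Hal|].
  destruct (Nat.eqb_spec j i); [lia|]. cbn [orb].
  replace (j - i + 1)%nat with (S (S (S (j - i - 2)))) by lia. apply wcoef_nonneg, Hal.
Qed.

Lemma gmat_row_sum (al : R) (i m : nat) :
  sum_f_R0 (fun j => gmat al i j) m
  = wsum al (S i) - (if Nat.leb m i then wsum al (i - m) else 0).
Proof.
  induction m as [|m IH].
  - simpl sum_f_R0. simpl Nat.leb. cbv iota. rewrite Nat.sub_0_r.
    unfold gmat, wsum. rewrite tech5. simpl. ring.
  - rewrite tech5, IH. unfold gmat.
    change (Nat.leb (S m) (S i)) with (Nat.leb m i).
    replace (S i - S m)%nat with (i - m)%nat by lia.
    destruct (Nat.leb_spec m i) as [H|H]; destruct (Nat.leb_spec (S m) i) as [H'|H'];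
      try lia; try ring.
    + replace (i - m)%nat with (S (i - S m)) by lia.
      unfold wsum at 2. rewrite tech5. fold (wsum al (i - S m)). ring.
    + replace (i - m)%nat with 0%nat by lia. change (wsum al 0) with (wcoef al 0). ring.
Qed.

Lemma gmat_col_sum (al : R) (i m : nat) :
  sum_f_R0 (fun j => gmat al j (S i)) m = if Nat.leb i m then wsum al (m - i) else 0.
Proof.
  induction m as [|m IH].
  - destruct i as [|i]; unfold gmat, wsum; simpl; reflexivity.
  - rewrite tech5, IH. unfold gmat.
    change (Nat.leb (S i) (S (S m))) with (Nat.leb i (S m)).
    replace (S (S m) - S i)%nat with (S m - i)%nat by lia.
    destruct (Nat.leb_spec i m) as [H|H].
    + rewrite (proj2 (Nat.leb_le i (S m))) by lia.
      replace (S m - i)%nat with (S (m - i)) by lia. reflexivity.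
    + destruct (Nat.leb_spec i (S m)) as [H'|H'].
      * replace (S m - i)%nat with 0%nat by lia. unfold wsum. simpl. ring.
      * ring.
Qed.

(** Over all columns from 0 to [M], the Grunwald part and its transpose sum to [wsum al (i + 1)] and
    [wsum al (M - i + 1)]. For an interior row both indices lie between 2 and [M], hence the factor
    2. *)
Lemma wmat_row_sum_le (al : R) (i M : nat) : 1 < al < 2 -> (1 <= i <= M - 1)%nat ->
  sum_f_R0 (fun j => wmat al i j) M
  <= - (2 * Rpower (INR M) (- al) / Rabs (Gamma (1 - al))).
Proof.
  intros Hal Hi. destruct i as [|i]; [lia|].
  rewrite (sum_eq _ (fun j => gmat al (S i) j + gmat al j (S i)))
    by (intros; apply wmat_gmat).
  rewrite plus_sum, gmat_row_sum, gmat_col_sum.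
  rewrite (proj2 (Nat.leb_le i M)) by lia.
  pose proof (wsum_le al (S (S i)) M Hal ltac:(lia)).
  pose proof (wsum_le al (M - i) M Hal ltac:(lia)).
  destruct (Nat.leb_spec M (S i)); [lia|]. lra.
Qed.

(** * Coercivity of the symmetric weights *)

Lemma sum_f_R0_switch (F : nat -> nat -> R) (n m : nat) :
  sum_f_R0 (fun i => sum_f_R0 (F i) m) n = sum_f_R0 (fun j => sum_f_R0 (fun i => F i j) n) m.
Proof.
  induction n as [|n IH]; [reflexivity|].
  rewrite tech5, IH, <- plus_sum. reflexivity.
Qed.

(** Off the diagonal [e_i e_j <= (e_i^2 + e_j^2) / 2], with nonnegative weight; on the diagonal
    equality holds. Symmetry then turns the two halves into the same row-sum expression. *)
Lemma sym_off_diag_nonneg_form_le (w : nat -> nat -> R) (e : nat -> R) (M : nat) :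
  (forall i j, w i j = w j i) -> (forall i j, i <> j -> 0 <= w i j) ->
  sum_f_R0 (fun i => e i * sum_f_R0 (fun j => w i j * e j) M) M
  <= sum_f_R0 (fun i => e i ^ 2 * sum_f_R0 (fun j => w i j) M) M.
Proof.
  intros Hs Hw.
  apply Rle_trans with
    (sum_f_R0 (fun i => sum_f_R0 (fun j => / 2 * (w i j * e i ^ 2) + / 2 * (w i j * e j ^ 2)) M) M).
  - apply sum_Rle. intros i _. rewrite scal_sum. apply sum_Rle. intros j _.
    destruct (Nat.eq_dec i j) as [->|Hij]; [apply Req_le; field|].
    pose proof (Hw i j Hij). pose proof (pow2_ge_0 (e i - e j)). nra.
  - apply Req_le.
    rewrite (sum_eq _ (fun i => sum_f_R0 (fun j => / 2 * (w i j * e i ^ 2)) M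
        + sum_f_R0 (fun j => / 2 * (w i j * e j ^ 2)) M)) by (intros; apply plus_sum).
    rewrite plus_sum, (sum_f_R0_switch (fun i j => / 2 * (w i j * e j ^ 2))), <- plus_sum.
    apply sum_eq. intros i _. rewrite <- plus_sum, scal_sum.
    apply sum_eq. intros j _. rewrite (Hs j i). field.
Qed.

Lemma wmat_form_le (al : R) (e : nat -> R) (M : nat) : 1 < al < 2 ->
  e 0%nat = 0 -> e M = 0 ->
  2 * Rpower (INR M) (- al) / Rabs (Gamma (1 - al)) * sum_f_R0 (fun i => e i ^ 2) M
  <= - sum_f_R0 (fun i => e i * sum_f_R0 (fun j => wmat al i j * e j) M) M.
Proof.
  intros Hal H0 HM.
  pose proof (sym_off_diag_nonneg_form_le (wmat al) e M (wmat_sym al)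
    (fun i j => wmat_off_diag_nonneg al i j Hal)) as H.
  set (c := 2 * Rpower (INR M) (- al) / Rabs (Gamma (1 - al))).
  assert (Hle : sum_f_R0 (fun i => e i ^ 2 * sum_f_R0 (fun j => wmat al i j) M) M
      <= - c * sum_f_R0 (fun i => e i ^ 2) M).
  { rewrite scal_sum. apply sum_Rle. intros i Hi.
    (* The row sum bound covers interior rows only; the boundary rows are multiplied by a vanishing
       [e]. *)
    destruct (Nat.eq_dec i 0) as [->|Hi0]; [rewrite H0; simpl; lra|].
    destruct (Nat.eq_dec i M) as [->|HiM]; [rewrite HM; simpl; lra|].
    apply Rmult_le_compat_l; [apply pow2_ge_0|]. apply wmat_row_sum_le; [exact Hal|lia]. }
  lra.
Qed.

(** * The energy estimate *)

Lemma fst_sum_n (f : nat -> C) (n : nat) : fst (sum_n f n) = sum_f_R0 (fun k => fst (f k)) n.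
Proof. induction n as [|n IH]; [rewrite sum_O; reflexivity|]. rewrite sum_Sn, tech5, <- IH. reflexivity. Qed.

Lemma snd_sum_n (f : nat -> C) (n : nat) : snd (sum_n f n) = sum_f_R0 (fun k => snd (f k)) n.
Proof. induction n as [|n IH]; [rewrite sum_O; reflexivity|]. rewrite sum_Sn, tech5, <- IH. reflexivity. Qed.

Lemma Cmod_sq (z : C) : Cmod z ^ 2 = fst z ^ 2 + snd z ^ 2.
Proof.
  unfold Cmod. rewrite pow2_sqrt; [reflexivity|].
  pose proof (pow2_ge_0 (fst z)). pose proof (pow2_ge_0 (snd z)). lra.
Qed.

Lemma wmat_form_C_le (al : R) (e : nat -> C) (M : nat) : 1 < al < 2 ->
  e 0%nat = RtoC 0 -> e M = RtoC 0 ->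
  2 * Rpower (INR M) (- al) / Rabs (Gamma (1 - al)) * sum_f_R0 (fun i => Cmod (e i) ^ 2) M
  <= - sum_f_R0 (fun i => fst (Cmult (Cconj (e i))
         (sum_n (fun j => Cmult (RtoC (wmat al i j)) (e j)) M))) M.
Proof.
  intros Hal H0 HM.
  pose proof (wmat_form_le al (fun i => fst (e i)) M Hal) as Hx. cbv beta in Hx.
  rewrite H0, HM in Hx. specialize (Hx eq_refl eq_refl).
  pose proof (wmat_form_le al (fun i => snd (e i)) M Hal) as Hy. cbv beta in Hy.
  rewrite H0, HM in Hy. specialize (Hy eq_refl eq_refl).
  rewrite (sum_eq (fun i => Cmod (e i) ^ 2) (fun i => fst (e i) ^ 2 + snd (e i) ^ 2))
    by (intros; apply Cmod_sq).
  rewrite (sum_eq (fun i => fst (Cmult (Cconj (e i)) _))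
    (fun i => fst (e i) * sum_f_R0 (fun j => wmat al i j * fst (e j)) M
      + snd (e i) * sum_f_R0 (fun j => wmat al i j * snd (e j)) M)).
  - rewrite !plus_sum. lra.
  - intros i _. unfold Cmult at 1, Cconj. cbn [fst snd].
    rewrite fst_sum_n, snd_sum_n.
    rewrite (sum_eq (fun k => fst _) (fun j => wmat al i j * fst (e j)))
      by (intros; unfold Cmult, RtoC; simpl; ring).
    rewrite (sum_eq (fun k => snd _) (fun j => wmat al i j * snd (e j)))
      by (intros; unfold Cmult, RtoC; simpl; ring).
    ring.
Qed.

Lemma exp_INR_mult (k : nat) (x : R) : exp (x * INR k) = exp x ^ k.
Proof.
  rewrite <- Rpower_pow by apply exp_pos. unfold Rpower. rewrite ln_exp. f_equal. ring.
Qed.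

Lemma l0_2_bdf2 (g lambda tau : R) :
  l0_2 g lambda tau = lcoef g 0 - rpow0 (bdf2 (exp (- lambda * tau))) g.
Proof.
  unfold l0_2. f_equal. f_equal. rewrite sum_n_Sm by lia. rewrite sum_n_n.
  unfold plus; simpl. unfold bdf2. field.
Qed.

(** The coefficient is [a k] times the phase [exp(-J th k)], with [a] real. Rotating [e n] by
    [exp(J th n)] absorbs the phases; [X] and [Y] are the real and imaginary parts of the rotated
    error, and the form is the sum of the real forms at [X] and [Y]. *)
Lemma tcoef_form_nonneg (g lambda rho eta tau Ui : R) (e : nat -> C) (N : nat) :
  0 < g < 1 -> 0 <= lambda -> 0 < rho -> 0 < tau -> 0 <= Ui ->
  0 <= sum_f_R0 (fun n => fst (Cmult (Cconj (e n))
         (sum_n (fun k => Cmult (tcoef g lambda rho eta tau Ui k) (e (n - k)%nat)) n))) N.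
Proof.
  intros Hg Hl Hr Ht HU.
  set (r := exp (- (lambda + rho * Ui) * tau)). set (r0 := exp (- lambda * tau)).
  set (th := eta * Ui * tau).
  set (X := fun n => cos (th * INR n) * fst (e n) - sin (th * INR n) * snd (e n)).
  set (Y := fun n => sin (th * INR n) * fst (e n) + cos (th * INR n) * snd (e n)).
  set (d := rpow0 (bdf2 r0) g).
  set (a := fun k => 1 * (lcoef g k * r ^ k) + (- d) * unit_seq k).
  assert (Hrr : 0 <= r <= r0).
  { split; [apply Rlt_le, exp_pos|]. apply exp_incr.
    assert (0 <= rho * Ui) by (apply Rmult_le_pos; lra). nra. }
  assert (Hr0 : r0 <= 1) by (rewrite <- exp_0; apply exp_incr; nra).
  assert (Ha : forall v, 0 <= ip N (conv a v) v).
  { intro v. pose proof (lcoef_form_nonneg g r r0 N v Hg Hrr Hr0) as H. fold d in H.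
    assert (E : forall n, conv a v n = 1 * conv (fun k => lcoef g k * r ^ k) v n + (- d) * v n).
    { intro n. unfold a. rewrite conv_lincomb. f_equal. f_equal.
      (* The case of the zeroth power says that [unit_seq] is neutral for [conv]. *)
      symmetry. apply (quad_pow_conv 0 0 0 0). }
    rewrite (ip_ext N _ _ _ _ E (fun n => eq_refl)), ip_lincomb. lra. }
  assert (Hphase : forall n k, (k <= n)%nat ->
    fst (Cmult (Cconj (e n)) (Cmult (tcoef g lambda rho eta tau Ui k) (e (n - k)%nat)))
    = a k * X (n - k)%nat * X n + a k * Y (n - k)%nat * Y n).
  { intros n k Hk.
    assert (Hcis : forall s x1 y1 x2 y2,
      (cos (th * INR (n - k)) * x2 - sin (th * INR (n - k)) * y2)
        * (cos (th * INR n) * x1 - sin (th * INR n) * y1)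
      + (sin (th * INR (n - k)) * x2 + cos (th * INR (n - k)) * y2)
        * (sin (th * INR n) * x1 + cos (th * INR n) * y1) = s ->
      s = cos (th * INR k) * (x1 * x2 + y1 * y2) + sin (th * INR k) * (x1 * y2 - y1 * x2)).
    { intros s x1 y1 x2 y2 <-.
      replace (th * INR k) with (th * INR n - th * INR (n - k))
        by (rewrite minus_INR by exact Hk; ring).
      rewrite cos_minus, sin_minus. ring. }
    assert (Et : tcoef g lambda rho eta tau Ui k
       = (a k * cos (th * INR k), - (a k * sin (th * INR k)))).
    { unfold a. destruct k as [|k].
      - simpl. rewrite l0_2_bdf2. fold r0 d. rewrite Rmult_0_r, cos_0, sin_0.
        unfold RtoC. f_equal; ring.
      - cbn [tcoef unit_seq]. set (m := S k) in *.
        replace (- (lambda + rho * Ui) * INR m * tau)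
          with ((- (lambda + rho * Ui) * tau) * INR m) by ring.
        rewrite exp_INR_mult. fold r.
        replace (- eta * Ui * INR m * tau) with (- (th * INR m)) by (unfold th; ring).
        unfold cexp, Jc, Cmult, RtoC; cbn [fst snd].
        replace (0 * - (th * INR m) - 1 * 0) with 0 by ring.
        replace (0 * 0 + 1 * - (th * INR m)) with (- (th * INR m)) by ring.
        rewrite exp_0, cos_neg, sin_neg. f_equal; ring. }
    rewrite Et.
    pose proof (Hcis _ (fst (e n)) (snd (e n)) (fst (e (n - k)%nat)) (snd (e (n - k)%nat)) eq_refl) as E.
    fold (X n) (Y n) (X (n - k)%nat) (Y (n - k)%nat) in E.
    transitivity (a k * (X (n - k)%nat * X n + Y (n - k)%nat * Y n)); [|ring].
    rewrite E. unfold Cmult, Cconj; cbn [fst snd]. ring. }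
  rewrite (sum_eq _ (fun n => conv a X n * X n + conv a Y n * Y n)).
  - rewrite plus_sum. apply Rplus_le_le_0_compat; apply Ha.
  - intros n _.
    assert (Hdist : forall (z : C) (f : nat -> C), fst (Cmult z (sum_n f n))
       = sum_f_R0 (fun k => fst (Cmult z (f k))) n).
    { intros z f. unfold Cmult. cbn [fst]. rewrite fst_sum_n, snd_sum_n, minus_sum, !scal_sum.
      f_equal; apply sum_eq; intros; ring. }
    rewrite Hdist. unfold conv.
    rewrite (Rmult_comm (sum_f_R0 _ n) (X n)), (Rmult_comm (sum_f_R0 _ n) (Y n)), !scal_sum, <- plus_sum.
    apply sum_eq. intros k Hk. apply Hphase, Hk.
Qed.

Lemma sum_n_Cmult_minus (c V W : nat -> C) (n : nat) :
  sum_n (fun k => Cmult (c k) (Cminus (V k) (W k))) n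
  = Cminus (sum_n (fun k => Cmult (c k) (V k)) n) (sum_n (fun k => Cmult (c k) (W k)) n).
Proof.
  induction n as [|n IH].
  - rewrite !sum_O. match goal with |- ?a = ?b => change (@eq C a b) end. ring.
  - rewrite !sum_Sn, IH. change (@plus C_AbelianMonoid) with Cplus.
    match goal with |- ?a = ?b => change (@eq C a b) end. ring.
Qed.

Lemma scheme_lhs_minus (g al lambda rho eta K b : R) (U : R -> R) (M : nat) (tau : R)
  (V W : nat -> nat -> C) (i n : nat) :
  scheme_lhs g al lambda rho eta K b U M tau (fun j m => Cminus (V j m) (W j m)) i n
  = Cminus (scheme_lhs g al lambda rho eta K b U M tau V i n)
           (scheme_lhs g al lambda rho eta K b U M tau W i n).
Proof. unfold scheme_lhs. rewrite !sum_n_Cmult_minus. ring. Qed.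

Lemma sum_n_m_1 (f : nat -> R) (N : nat) : (1 <= N)%nat -> f 0%nat = 0 ->
  sum_n_m f 1 N = sum_f_R0 f N.
Proof.
  intros HN H0. destruct N as [|N]; [lia|]. clear HN.
  induction N as [|N IH].
  - rewrite sum_n_n. simpl. rewrite H0. ring.
  - rewrite sum_n_Sm by lia. rewrite tech5, <- IH. reflexivity.
Qed.

Lemma fst_Cmult_Cconj_le (z w : C) : fst (Cmult (Cconj z) w) <= Cmod z * Cmod w.
Proof.
  rewrite <- (Cmod_conj z), <- Cmod_mult.
  eapply Rle_trans; [apply Rle_abs|].
  eapply Rle_trans; [|apply Rmax_Cmod]. apply Rmax_l.
Qed.

(** Test the residual with the conjugate error and sum over the whole index rectangle; the time form
    is dropped by its sign. The alternative [e i n = 0] lets the rectangle include the initial level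
    and the boundary, where no scheme equation holds but the tested term vanishes. *)
Lemma error_energy_le (g al lambda rho eta K b : R) (U : R -> R) (M N : nat) (tau : R)
  (e : nat -> nat -> C) (res : R) :
  0 < g < 1 -> 1 < al < 2 -> 0 <= lambda -> 0 < rho -> 0 < tau -> 0 < kappa K al ->
  (forall i, (i <= M)%nat -> 0 <= U (xg b M i)) ->
  (forall n, (n <= N)%nat -> e 0%nat n = RtoC 0 /\ e M n = RtoC 0) ->
  (forall i n, (i <= M)%nat -> (n <= N)%nat -> e i n = RtoC 0 \/
     Cmod (scheme_lhs g al lambda rho eta K b U M tau e i n) <= res) ->
  kappa K al / Rpower (hstep b M) al * (2 * Rpower (INR M) (- al) / Rabs (Gamma (1 - al)))
    * sum_f_R0 (fun n => sum_f_R0 (fun i => Cmod (e i n) ^ 2) M) N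
  <= res * sum_f_R0 (fun n => sum_f_R0 (fun i => Cmod (e i n)) M) N.
Proof.
  intros Hg Hal Hl Hr Ht Hk HU Hbd Hres.
  set (k := kappa K al / Rpower (hstep b M) al).
  assert (Hkp : 0 < k) by (apply Rdiv_lt_0_compat; [exact Hk | apply Rpower_pos]).
  set (F := fun i n => fst (Cmult (Cconj (e i n)) (sum_n (fun k =>
     Cmult (tcoef g lambda rho eta tau (U (xg b M i)) k) (e i (n - k)%nat)) n))).
  set (H := fun i n => fst (Cmult (Cconj (e i n))
     (sum_n (fun j => Cmult (RtoC (wmat al i j)) (e j n)) M))).
  assert (HFH : forall i n, (i <= M)%nat -> (n <= N)%nat ->
    / Rpower tau g * F i n - k * H i n <= res * Cmod (e i n)).
  { intros i n Hi Hn.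
    destruct (Hres i n Hi Hn) as [E|E].
    - unfold F, H. rewrite E, Cmod_0. unfold Cconj, Cmult, RtoC; cbn [fst snd]. lra.
    - apply Rle_trans with (Cmod (e i n) * Cmod (scheme_lhs g al lambda rho eta K b U M tau e i n)).
      + eapply Rle_trans; [|apply fst_Cmult_Cconj_le]. apply Req_le.
        unfold scheme_lhs, F, H, k.
        generalize (sum_n (fun k =>
          Cmult (tcoef g lambda rho eta tau (U (xg b M i)) k) (e i (n - k)%nat)) n).
        generalize (sum_n (fun j => Cmult (RtoC (wmat al i j)) (e j n)) M).
        intros z w. unfold Cconj, Cmult, Cplus, Copp, RtoC; cbn [fst snd]. ring.
      + rewrite (Rmult_comm res). apply Rmult_le_compat_l; [apply Cmod_ge_0 | exact E]. }
  assert (Hsum : sum_f_R0 (fun n => sum_f_R0 (fun i => / Rpower tau g * F i n - k * H i n) M) N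
    <= res * sum_f_R0 (fun n => sum_f_R0 (fun i => Cmod (e i n)) M) N).
  { rewrite scal_sum. apply sum_Rle. intros n Hn. rewrite Rmult_comm, scal_sum.
    apply sum_Rle. intros i Hi. rewrite (Rmult_comm _ res). apply HFH; assumption. }
  assert (HF : 0 <= sum_f_R0 (fun n => sum_f_R0 (fun i => F i n) M) N).
  { rewrite sum_f_R0_switch.
    replace 0 with (sum_f_R0 (fun _ => 0) M) by (rewrite sum_cte; ring).
    apply sum_Rle. intros i Hi. apply tcoef_form_nonneg; try assumption. apply HU, Hi. }
  set (c := 2 * Rpower (INR M) (- al) / Rabs (Gamma (1 - al))).
  assert (HH : c * sum_f_R0 (fun n => sum_f_R0 (fun i => Cmod (e i n) ^ 2) M) N
    <= - sum_f_R0 (fun n => sum_f_R0 (fun i => H i n) M) N).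
  { replace (- sum_f_R0 (fun n => sum_f_R0 (fun i => H i n) M) N)
      with (sum_f_R0 (fun n => - sum_f_R0 (fun i => H i n) M) N).
    2:{ replace (- sum_f_R0 (fun n => sum_f_R0 (fun i => H i n) M) N)
          with (-1 * sum_f_R0 (fun n => sum_f_R0 (fun i => H i n) M) N) by ring.
        rewrite scal_sum. apply sum_eq. intros; ring. }
    rewrite scal_sum. apply sum_Rle. intros n Hn. rewrite Rmult_comm.
    apply (wmat_form_C_le al (fun i => e i n) M Hal); apply Hbd; exact Hn. }
  assert (Hsplit : sum_f_R0 (fun n => sum_f_R0 (fun i => / Rpower tau g * F i n - k * H i n) M) N
    = / Rpower tau g * sum_f_R0 (fun n => sum_f_R0 (fun i => F i n) M) N
      - k * sum_f_R0 (fun n => sum_f_R0 (fun i => H i n) M) N).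
  { rewrite !scal_sum, <- minus_sum. apply sum_eq. intros n _.
    rewrite !(Rmult_comm (sum_f_R0 _ M)), !scal_sum, <- minus_sum.
    apply sum_eq. intros; ring. }
  pose proof (Rpower_pos tau g) as Hp. apply Rinv_0_lt_compat in Hp.
  assert (0 <= / Rpower tau g * sum_f_R0 (fun n => sum_f_R0 (fun i => F i n) M) N)
    by (apply Rmult_le_pos; lra).
  apply (Rmult_le_compat_l k) in HH; [|lra]. lra.
Qed.

(** * From the energy inequality to the norm of the error *)

Definition pos_ind (n : nat) : R := match n with O => 0 | S _ => 1 end.

(** Index 0 carries no error and is given weight 0, so the counts are [N] and [M] instead of [N + 1]
    and [M + 1]; the stated constant depends on this. *)
Lemma sum_pos_ind (N : nat) : sum_f_R0 pos_ind N = INR N.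
Proof. induction N as [|N IH]; [reflexivity|]. rewrite tech5, IH, S_INR. reflexivity. Qed.

(* Absorption in place of Cauchy-Schwarz: [2 th |u| <= |u|^2 + th^2] at each of the [N M]
   points with positive indices. *)
Lemma sum_sq_le_of_sum_le (u : nat -> nat -> R) (th : R) (M N : nat) : 0 <= th ->
  (forall n, (n <= N)%nat -> u 0%nat n = 0) -> (forall i, (i <= M)%nat -> u i 0%nat = 0) ->
  sum_f_R0 (fun n => sum_f_R0 (fun i => u i n ^ 2) M) N
    <= th * sum_f_R0 (fun n => sum_f_R0 (fun i => u i n) M) N ->
  sum_f_R0 (fun n => sum_f_R0 (fun i => u i n ^ 2) M) N <= th ^ 2 * INR M * INR N.
Proof.
  intros Hth H0 H0' H.
  assert (E : 2 * th * sum_f_R0 (fun n => sum_f_R0 (fun i => u i n) M) N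
    <= sum_f_R0 (fun n => sum_f_R0 (fun i => u i n ^ 2) M) N + th ^ 2 * INR M * INR N).
  { rewrite <- (sum_pos_ind N), !scal_sum, <- plus_sum. apply sum_Rle. intros n Hn.
    rewrite (Rmult_comm (pos_ind n)), (Rmult_assoc (th ^ 2)), <- (sum_pos_ind M),
      (Rmult_comm (sum_f_R0 pos_ind M)), Rmult_comm, <- Rmult_assoc, !scal_sum, <- plus_sum.
    apply sum_Rle. intros i Hi. cbv beta.
    destruct i as [|i]; [rewrite H0 by exact Hn; simpl; lra|].
    destruct n as [|n]; [rewrite H0' by exact Hi; simpl; lra|].
    cbn [pos_ind]. pose proof (pow2_ge_0 (u (S i) (S n) - th)). lra. }
  lra.
Qed.

Lemma kappa_pos (K al : R) : 0 < K -> 1 < al < 2 -> 0 < kappa K al.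
Proof.
  intros HK Hal. unfold kappa, kappa_alpha. pose proof PI_RGT_0.
  assert (Hc : cos (al * PI / 2) < 0) by (apply cos_lt_0; nra).
  assert (/ (2 * cos (al * PI / 2)) < 0) by (apply Rinv_lt_0_compat; lra). nra.
Qed.

(** A second absorption, now in time only, against the level [ph = th * sqrt b]. The factor [sqrt b]
    comes from [h * M = b], which turns the count of grid points into a length. *)
Lemma dnorm_sum_le (b : R) (M N : nat) (e : nat -> nat -> C) (th : R) :
  0 < b -> (2 <= M)%nat -> (1 <= N)%nat -> 0 < th ->
  (forall n, (n <= N)%nat -> e 0%nat n = RtoC 0 /\ e M n = RtoC 0) ->
  (forall i, (i <= M)%nat -> e i 0%nat = RtoC 0) ->
  sum_f_R0 (fun n => sum_f_R0 (fun i => Cmod (e i n) ^ 2) M) N <= th ^ 2 * INR M * INR N ->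
  sum_n_m (fun n => dnorm b M (fun i => e i n)) 1 N <= INR N * (th * sqrt b).
Proof.
  intros Hb HM HN Hth Hbd H0 H.
  assert (HMp : 0 < INR M) by (apply lt_0_INR; lia).
  assert (Hh : 0 < hstep b M) by (apply Rdiv_lt_0_compat; lra).
  assert (Hsq : forall n, (n <= N)%nat ->
    dnorm b M (fun i => e i n) ^ 2 = hstep b M * sum_f_R0 (fun i => Cmod (e i n) ^ 2) M).
  { intros n Hn. destruct (Hbd n Hn) as [E0 EM]. unfold dnorm.
    rewrite sum_n_m_1 by (rewrite ?E0, ?Cmod_0; (lia || simpl; ring)).
    rewrite pow2_sqrt.
    - destruct M as [|M']; [lia|]. rewrite (tech5 _ M'), EM, Cmod_0.
      replace (S M' - 1)%nat with M' by lia. simpl; ring.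
    - apply Rmult_le_pos; [lra|]. apply cond_pos_sum. intro; apply pow2_ge_0. }
  assert (Hd0 : dnorm b M (fun i => e i 0%nat) = 0).
  { assert (E : dnorm b M (fun i => e i 0%nat) ^ 2 = 0).
    { rewrite Hsq by lia. rewrite (sum_eq _ (fun _ => 0)).
      - rewrite sum_cte. ring.
      - intros i Hi. rewrite H0, Cmod_0 by exact Hi. simpl; ring. }
    apply Rsqr_0_uniq. unfold Rsqr. simpl in E. lra. }
  rewrite sum_n_m_1 by assumption.
  set (ph := th * sqrt b).
  assert (Hsb : 0 < sqrt b) by (apply sqrt_lt_R0; exact Hb).
  assert (Hph : 0 < ph) by (apply Rmult_lt_0_compat; assumption).
  assert (E : 2 * ph * sum_f_R0 (fun n => dnorm b M (fun i => e i n)) N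
    <= hstep b M * sum_f_R0 (fun n => sum_f_R0 (fun i => Cmod (e i n) ^ 2) M) N
       + ph ^ 2 * INR N).
  { rewrite <- (sum_pos_ind N), !scal_sum, <- plus_sum. apply sum_Rle. intros n Hn.
    rewrite (Rmult_comm (sum_f_R0 _ M)), <- Hsq by exact Hn.
    destruct n as [|n]; [rewrite Hd0; simpl; lra|]. cbn [pos_ind].
    pose proof (pow2_ge_0 (dnorm b M (fun i => e i (S n)) - ph)). lra. }
  assert (E2 : hstep b M * sum_f_R0 (fun n => sum_f_R0 (fun i => Cmod (e i n) ^ 2) M) N
    <= ph ^ 2 * INR N).
  { apply Rle_trans with (hstep b M * (th ^ 2 * INR M * INR N)).
    - apply Rmult_le_compat_l; lra.
    - apply Req_le. unfold ph, hstep. rewrite Rpow_mult_distr, pow2_sqrt by lra. field. lra. }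
  apply Rmult_le_reg_l with (2 * ph); [lra|]. lra.
Qed.

(** In the constant, [b^alpha |Gamma(1 - alpha)| / (2 kappa)] is the inverse of the spatial
    coercivity, [b^(1/2)] comes from the discrete norm, and [T] bounds [N * tau]. *)
Theorem theorem3p10
  (gamma alpha lambda rho eta K b T : R) (U : R -> R)
  (f : R -> C -> R -> C) (G : R -> C -> R -> C)
  (M N : nat) (tau CG : R) (Gn : nat -> nat -> C) :
  0 < gamma < 1 -> 1 < alpha < 2 -> 0 <= lambda -> 0 < rho ->
  0 < K -> 0 < b -> 0 < T ->
  (forall x, 0 <= x <= b -> 0 <= U x) ->
  (* G vanishes for x outside (0,b), in particular at x = 0 and x = b *)
  (forall t, 0 < t <= T -> G 0 (rho, eta) t = RtoC 0 /\ G b (rho, eta) t = RtoC 0) ->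
  (2 <= M)%nat -> (1 <= N)%nat -> 0 < tau -> INR N * tau <= T ->
  (* the numerical scheme *)
  (forall i, (i <= M)%nat -> Gn i 0%nat = G (xg b M i) (rho, eta) 0) ->
  (forall n, (1 <= n <= N)%nat -> Gn 0%nat n = RtoC 0 /\ Gn M n = RtoC 0) ->
  (forall i n, (1 <= i <= M - 1)%nat -> (1 <= n <= N)%nat ->
     scheme_lhs gamma alpha lambda rho eta K b U M tau Gn i n =
     scheme_rhs gamma lambda rho eta b U f M tau (Gn i 0%nat) i n) ->
  (* local truncation error bound *)
  0 < CG ->
  (forall i n, (1 <= i <= M - 1)%nat -> (1 <= n <= N)%nat ->
     Cmod (Cminus
       (scheme_lhs gamma alpha lambda rho eta K b U M tau
          (fun j m => G (xg b M j) (rho, eta) (tg tau m)) i n)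
       (scheme_rhs gamma lambda rho eta b U f M tau
          (G (xg b M i) (rho, eta) 0) i n))
     <= CG * (tau ^ 2 + hstep b M ^ 2)) ->
  tau * sum_n_m (fun n => dnorm b M
                   (fun i => Cminus (G (xg b M i) (rho, eta) (tg tau n)) (Gn i n))) 1 N
  <= CG * Rabs (Gamma (1 - alpha)) * Rpower b (alpha + / 2) * T
     / (2 * kappa K alpha) * (tau ^ 2 + hstep b M ^ 2).
Proof.
  intros Hg Hal Hl Hr HK Hb HT HU HG HM HN Htau HNT Hinit Hbc Hscheme HCG Htrunc.
  set (e := fun i n => Cminus (G (xg b M i) (rho, eta) (tg tau n)) (Gn i n)).
  assert (HMp : 0 < INR M) by (apply lt_0_INR; lia).
  assert (Hh : 0 < hstep b M) by (apply Rdiv_lt_0_compat; lra).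
  assert (Hx0 : xg b M 0 = 0) by (unfold xg; simpl; ring).
  assert (HxM : xg b M M = b) by (unfold xg, hstep; field; lra).
  assert (He0 : forall i, (i <= M)%nat -> e i 0%nat = RtoC 0).
  { intros i Hi. unfold e. rewrite Hinit by exact Hi. unfold tg. rewrite Rmult_0_l. ring. }
  assert (Hebd : forall n, (n <= N)%nat -> e 0%nat n = RtoC 0 /\ e M n = RtoC 0).
  { intros [|n] Hn; [split; apply He0; lia|].
    assert (Ht : 0 < tg tau (S n) <= T).
    { unfold tg. split; [apply Rmult_lt_0_compat; [apply lt_0_INR; lia | exact Htau]|].
      eapply Rle_trans; [|exact HNT]. apply Rmult_le_compat_r; [lra | apply le_INR, Hn]. }
    destruct (HG _ Ht) as [G0 GM]. destruct (Hbc (S n) ltac:(lia)) as [B0 BM].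
    unfold e. rewrite Hx0, HxM, G0, GM, B0, BM. split; ring. }
  set (res := CG * (tau ^ 2 + hstep b M ^ 2)).
  assert (Hres : 0 < res).
  { apply Rmult_lt_0_compat; [exact HCG|].
    assert (0 < tau ^ 2) by (apply pow_lt; exact Htau). pose proof (pow2_ge_0 (hstep b M)). lra. }
  pose proof (kappa_pos K alpha HK Hal) as Hk.
  pose proof (error_energy_le gamma alpha lambda rho eta K b U M N tau e res
    Hg Hal Hl Hr Htau Hk) as Hen.
  assert (HU' : forall i, (i <= M)%nat -> 0 <= U (xg b M i)).
  { intros i Hi. apply HU. split; [apply Rmult_le_pos; [apply pos_INR | lra]|].
    apply Rle_trans with (xg b M M); [|lra].
    apply Rmult_le_compat_r; [lra | apply le_INR, Hi]. }
  specialize (Hen HU' Hebd).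
  assert (Hstep : forall i n, (i <= M)%nat -> (n <= N)%nat -> e i n = RtoC 0 \/
     Cmod (scheme_lhs gamma alpha lambda rho eta K b U M tau e i n) <= res).
  { intros i n Hi Hn.
    destruct (Nat.eq_dec n 0) as [->|Hn0]; [left; apply He0, Hi|].
    destruct (Nat.eq_dec i 0) as [->|Hi0]; [left; apply Hebd, Hn|].
    destruct (Nat.eq_dec i M) as [->|HiM]; [left; apply Hebd, Hn|].
    right. unfold e. rewrite scheme_lhs_minus.
    rewrite (Hscheme i n) by lia. rewrite Hinit by exact Hi. apply Htrunc; lia. }
  specialize (Hen Hstep).
  destruct (Gamma_reflect alpha Hal) as [EG HGp].
  set (Ga := Rabs (Gamma (1 - alpha))) in *.
  assert (HGa : 0 < Ga) by (rewrite EG; apply Rdiv_lt_0_compat; lra).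
  pose proof (Rpower_pos b alpha) as Hba.
  (* [h^alpha * M^alpha = b^alpha]: the decay of the row sums cancels the mesh factor, so the
     coercivity is independent of [M]. *)
  assert (Hcoef : kappa K alpha / Rpower (hstep b M) alpha
      * (2 * Rpower (INR M) (- alpha) / Ga) = 2 * kappa K alpha / (Rpower b alpha * Ga)).
  { rewrite Rpower_Ropp.
    replace (Rpower b alpha) with (Rpower (hstep b M) alpha * Rpower (INR M) alpha).
    - pose proof (Rpower_pos (hstep b M) alpha). pose proof (Rpower_pos (INR M) alpha).
      field. lra.
    - rewrite Rpower_mult_distr by lra. f_equal. unfold hstep. field. lra. }
  rewrite Hcoef in Hen.
  (* Residual bound divided by coercivity: the energy inequality becomes the bound of the sum of
     [|e|^2] by [th] times the sum of [|e|]. *)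
  set (th := res * (Rpower b alpha * Ga) / (2 * kappa K alpha)).
  assert (HbG : 0 < Rpower b alpha * Ga) by (apply Rmult_lt_0_compat; assumption).
  assert (Hth : 0 < th).
  { apply Rdiv_lt_0_compat; [apply Rmult_lt_0_compat; assumption | lra]. }
  assert (HZ : sum_f_R0 (fun n => sum_f_R0 (fun i => Cmod (e i n) ^ 2) M) N
     <= th ^ 2 * INR M * INR N).
  { apply (sum_sq_le_of_sum_le (fun i n => Cmod (e i n))); [lra | | |].
    - intros n Hn. destruct (Hebd n Hn) as [-> _]. apply Cmod_0.
    - intros i Hi. rewrite He0 by exact Hi. apply Cmod_0.
    - apply (Rmult_le_compat_l (Rpower b alpha * Ga / (2 * kappa K alpha))) in Hen.
      + eapply Rle_trans; [|eapply Rle_trans; [exact Hen|]]; apply Req_le.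
        * field. lra.
        * unfold th. field. lra.
      + apply Rlt_le, Rdiv_lt_0_compat; lra. }
  pose proof (dnorm_sum_le b M N e th Hb HM HN Hth Hebd He0 HZ) as Hd.
  apply Rle_trans with (tau * (INR N * (th * sqrt b))).
  { apply Rmult_le_compat_l; [lra | exact Hd]. }
  assert (Hsb : 0 < sqrt b) by (apply sqrt_lt_R0; exact Hb).
  apply Rle_trans with (T * (th * sqrt b)).
  { rewrite <- Rmult_assoc. apply Rmult_le_compat_r; [apply Rmult_le_pos; lra | lra]. }
  apply Req_le. rewrite Rpower_plus, Rpower_sqrt by exact Hb. unfold th, res. field. lra.
Qed.
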